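(* The Chabauty compactification $\overline{\mathrm{Cartan}(\mathrm{SL}_3(\mathbb{R}))}^{\mathcal{S}}$ coincides with the space $\mathcal{A}(\mathrm{SL}_3(\mathbb{R}))$.
   Context: Let $G=\mathrm{SL}_3(\mathbb{R})$. A Cartan subgroup of $G$ is a conjugate in $G$ of the group $A$ of diagonal matrices with positive diagonal entries and determinant $1$. $\mathcal{S}(G)$ is the space of closed subgroups of $G$ with the Chabauty topology, which is compact and metrizable: $H_n \to H$ if and only if every $h\in H$ is a limit of a sequence $h_n \in H_n$, and every limit of a sequence $(h_n)_{n\in P}$ with $P\subset\mathbb{N}$ infinite and $h_n\in H_n$ for all $n\in P$ belongs to $H$. $\mathrm{Cartan}(G)\subset\mathcal{S}(G)$ is the space of Cartan subgroups and $\overline{\mathrm{Cartan}(G)}^{\mathcal{S}}$ is its closure. $\mathcal{A}(G)$ is the set of closed connected abelian subgroups of $G$ of dimension $2$ (the real rank of $G$) contained in a Borel subgroup of $G$, i.e. in a conjugate of the group of upper triangular matrices of $G$. *)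

(* Defs.v *)
From HB Require Import structures.
From mathcomp Require Import all_boot all_order all_algebra perm.
From mathcomp Require Import all_classical all_reals all_analysis.

Set Implicit Arguments.
Unset Strict Implicit.
Unset Printing Implicit Defensive.

Import Order.TTheory GRing.Theory Num.Theory.
Import numFieldNormedType.Exports.

Local Open Scope classical_set_scope.
Local Open Scope ring_scope.

Section subgroups.
Variable R : realType.
Local Notation M3 := 'M[R]_3.

Definition SL3 : set M3 := [set g | \det g = 1].

Lemma closed_SL3 : closed SL3.
Proof.
have cont_det : continuous (fun g : M3 => \det g).
  refine (@continuous_big R _ +%R 0 _ (@add_continuous R) M3 _
    (fun (s : {perm 'I_3}) g => (-1) ^+ s * \prod_i g i (s i)) _) => s _ g.
  apply: (@cvgM R M3 (nbhs g) _ (fun=> (-1) ^+ s)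
    (fun h : M3 => \prod_i h i (s i))); first exact: cvg_cst.
  by refine (@continuous_big R _ *%R 1 _ (@mul_continuous R) M3 _
    (fun i g => g i (s i)) _ g) => i _; exact: coord_continuous.
rewrite (_ : SL3 = (fun g : M3 => \det g) @^-1` [set x | x = 1]) //.
by apply: preimage_closed => [g _|]; [exact: cont_det | exact: closed_eq].
Qed.

(* SL_3(R) carries the subspace topology of M_3(R) and is closed in it (see
   closed_SL3 above), so that a subset of SL_3(R) is closed in SL_3(R) if and
   only if it is closed in M_3(R), and likewise for compact subsets. *)
Definition is_closed_subgroup (H : set M3) : Prop :=
  [/\ H `<=` SL3, closed H, H 1%:M,
      forall x y, H x -> H y -> H (x *m y) &
      forall x, H x -> H (invmx x)].

Record closedSubgroup := ClosedSubgroup {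
  csub_set :> set M3;
  csubP : is_closed_subgroup csub_set }.

HB.instance Definition _ := gen_eqMixin closedSubgroup.
HB.instance Definition _ := gen_choiceMixin closedSubgroup.

Definition csub_hit (U : set M3) : set closedSubgroup :=
  [set H : closedSubgroup | (H : set M3) `&` U !=set0].

Definition csub_miss (K : set M3) : set closedSubgroup :=
  [set H : closedSubgroup | (H : set M3) `&` K = set0].

Definition chabauty_subbase : set (set closedSubgroup) :=
  [set B | (exists2 U : set M3, open U & B = csub_hit U) \/
           (exists2 K : set M3, compact K & B = csub_miss K)].

(* The Chabauty topology; its convergent sequences are described by
   csub_cvgP below. *)
HB.instance Definition _ :=
  @isSubBaseTopological.Build closedSubgroup (set closedSubgroup)
    chabauty_subbase id.

Lemma open_csub_hit (U : set M3) : open U -> open (csub_hit U).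
Proof.
move=> oU; exists [set csub_hit U]; last by rewrite bigcup_set1.
by move=> _ ->; apply: (@finI_from1 _ _ _ id); left; exists U.
Qed.

Lemma open_csub_miss (K : set M3) : compact K -> open (csub_miss K).
Proof.
move=> cK; exists [set csub_miss K]; last by rewrite bigcup_set1.
by move=> _ ->; apply: (@finI_from1 _ _ _ id); right; exists K.
Qed.

Lemma cvg_csub (F : set_system closedSubgroup) (H : closedSubgroup) :
  Filter F ->
  (forall U, open U -> csub_hit U H -> F (csub_hit U)) ->
  (forall K, compact K -> csub_miss K H -> F (csub_miss K)) ->
  F --> H.
Proof.
move=> FF FU FK A; rewrite nbhsE => -[_ [[D sD <-] [B DB BH]] sA].
have /sD [E sE eB] := DB.
apply: filterS sA _; apply: (@filterS _ _ _ B); first by move=> x Bx; exists B.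
rewrite -eB; apply: filter_bigI => C EC.
have CH : C H by move: BH; rewrite -eB; exact.
have /sE := EC; rewrite inE => -[[U oU eC]|[K cK eC]]; move: CH; rewrite eC.
  exact: FU.
exact: FK.
Qed.

Lemma cvg_mx_coord m n (T : Type) (F : set_system T) (f : T -> 'M[R]_(m, n))
    (x : 'M[R]_(m, n)) :
  Filter F -> (forall i j, f t i j @[t --> F] --> x i j) -> f @ F --> x.
Proof.
move=> FF cf A [P nP sPA]; apply: (@filterS _ _ _ [set t | forall i j,
  P i j (f t i j)]); first by move=> t Pt; exact: sPA.
by do 2 apply: filter_forall => ?; exact: cf.
Qed.

Lemma compact_box (h : M3) (e : R) :
  compact [set x : M3 | forall i j, x i j \in `[h i j - e, h i j + e]].
Proof.
pose Q := [set v : 'rV[R]_(3 * 3) | forall k,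
  `[mxvec h ord0 k - e, mxvec h ord0 k + e]%classic (v ord0 k)].
have cQ : compact Q.
  apply: (@rV_compact _ _ (fun k =>
    `[mxvec h ord0 k - e, mxvec h ord0 k + e]%classic)) => k.
  exact: segment_compact.
rewrite [X in compact X](_ : _ = vec_mx @` Q).
  apply: continuous_compact cQ; apply: continuous_subspaceT => v.
  apply: (@cvg_mx_coord 3 3 _ (nbhs v) vec_mx) => i j; rewrite mxE.
  under eq_cvg do rewrite mxE.
  exact: coord_continuous.
apply/seteqP; split=> [x xh|_ [v Qv <-] i j].
  exists (mxvec x); last exact: mxvecK.
  by move=> k; case/mxvec_indexP: k => i j; rewrite /= !mxvecE; exact: xh.
by have := Qv (mxvec_index i j); rewrite /= mxvecE mxE.
Qed.

Lemma csub_cvgP (Hn : nat -> closedSubgroup) (H : closedSubgroup) :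
  Hn @ \oo --> H <->
  (forall h, csub_set H h ->
     exists2 u : nat -> M3, (forall n, csub_set (Hn n) (u n)) &
     u @ \oo --> h) /\
  (forall (phi : nat -> nat) (u : nat -> M3) (h : M3),
     {homo phi : m n / (m < n)%N} -> (forall k, csub_set (Hn (phi k)) (u k)) ->
     u @ \oo --> h -> csub_set H h).
Proof.
split=> [HnH|[lim_in lim_out]].
  split=> [h Hh|phi u h phi_homo Hu uh].
    pose D n := [set `|h - x| | x in csub_set (Hn n)].
    have infD n : has_inf (D n).
      split; last by exists 0 => _ [x _ <-].
      have [_ _ Hn1 _ _] := csubP (Hn n).
      by exists `|h - 1%:M|, 1%:M.
    have ex n : exists x,
        csub_set (Hn n) x /\ `|h - x| < inf (D n) + n.+1%:R^-1.
      have n0 : 0 < n.+1%:R^-1 :> R by [].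
      by have [_ [x Hx <-]] := inf_adherent n0 (infD n); exists x.
    have /choice[u Pu] := ex.
    exists u => [n|]; first by have [] := Pu n.
    apply/cvgrPdist_lt => e e0.
    have e20 : 0 < e / 2 by rewrite divr_gt0.
    have : \forall n \near \oo, csub_hit (ball h (e / 2)) (Hn n).
      apply: HnH; apply: open_nbhs_nbhs; split.
        exact/open_csub_hit/ball_open.
      by exists h; split=> //; exact: ballxx.
    move=> hit; near=> n.
    have [_ /lt_trans] := Pu n; apply.
    rewrite [ltRHS](splitr e) ltrD//.
      have [x [Hx hx]] : csub_hit (ball h (e / 2)) (Hn n) by near: n.
      apply: (@le_lt_trans _ _ `|h - x|); last by move: hx; rewrite -ball_normE.
      by apply: ge_inf; [case: (infD n) | exists x].
    by near: n; exact: near_infty_natSinv_lt (PosNum e20).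
  apply: contrapT => nHh.
  have [_ clH _ _ _] := csubP H.
  have /nbhs_ballP[e e0 eH] : nbhs h (~` csub_set H).
    by apply: open_nbhs_nbhs; split=> //; exact: closed_openC.
  pose K := [set x : M3 | forall i j,
    x i j \in `[h i j - e / 2, h i j + e / 2]].
  have e20 : 0 < e / 2 by rewrite divr_gt0.
  have : \forall n \near \oo, csub_miss K (Hn n).
    apply: HnH; apply: open_nbhs_nbhs; split.
      exact/open_csub_miss/compact_box.
    rewrite /csub_miss /= -subset0 => x [Hx Kx]; apply: (eH x) => //.
    split=> // i j; rewrite -ball_normE /=.
    have := Kx i j; rewrite in_itv /= -ler_distlC => /le_lt_trans; apply.
    by rewrite ltr_pdivrMr// ltr_pMr// ltr1n.
  move=> [N _ missN].
  have [M _ nearM] : \forall n \near \oo, ball h (e / 2) (u n).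
    by apply: uh; exact: nbhsx_ballx.
  have le_phi k : (k <= phi k)%N.
    by elim: k => // k IH; exact: leq_ltn_trans IH (phi_homo _ _ (ltnSn k)).
  have := missN (phi (maxn N M)) (leq_trans (leq_maxl N M) (le_phi _)).
  rewrite /csub_miss /= -subset0; apply; split; first exact: Hu.
  move=> i j.
  have [_ /(_ i j)] := nearM (maxn N M) (leq_maxr N M).
  by rewrite -ball_normE /= in_itv /= -ler_distlC => /ltW.
apply: cvg_csub => [U oU [h [Hh Uh]]|K cK missK].
  have [u Hu uh] := lim_in h Hh.
  have : \forall n \near \oo, U (u n) by apply: uh; exact: open_nbhs_nbhs.
  by apply: filterS => n Un; exists (u n).
apply: contrapT => nmiss.
pose P n := csub_set (Hn n) `&` K !=set0.
have freqP N : exists2 n, (N <= n)%N & P n.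
  apply: contrapT => nP; apply: nmiss; exists N => // n Nn /=.
  rewrite /csub_miss /= -subset0 => x HKx; apply: nP; exists n => //.
  by exists x.
have /choice[x HKx] : forall n, exists y, P n -> (csub_set (Hn n) `&` K) y.
  move=> n.
  have [[y]|nP] := pselect (P n); first by exists y.
  by exists 0.
pose G := within P \oo.
have GF : ProperFilter G.
  apply: Build_ProperFilter_ex => B [N _ NB].
  by have [n /NB Bn /Bn] := freqP N; exists n.
have GK : (x @ G) K by exists 0%N => // n _ /HKx[].
have [p [Kp clp]] := cK (x @ G) _ GK.
have ex k m : exists n, [/\ (m < n)%N, P n & ball p k.+1%:R^-1 (x n)].
  have xGm : (x @ G) [set y | exists2 n, (m < n)%N & P n /\ y = x n].
    by exists m.+1 => // n mn Pn; exists n.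
  have [|_ [[n mn [Pn ->]] pn]] := clp _ (ball p k.+1%:R^-1) xGm.
    exact: nbhsx_ballx.
  by exists n.
have {}/choice[f Pf] : forall km : nat * nat,
    exists n, [/\ (km.2 < n)%N, P n & ball p km.1.+1%:R^-1 (x n)].
  by case=> k m; exact: ex.
pose phi := fix phi k := if k is k'.+1 then f (k, phi k') else f (0, 0)%N.
have phiP k : P (phi k) /\ ball p k.+1%:R^-1 (x (phi k)).
  by case: k => [|k] /=; [have [] := Pf (0, 0)%N | have [] := Pf (k.+1, phi k)].
have phi_homo : {homo phi : m n / (m < n)%N}.
  apply: homo_ltn; first exact: ltn_trans.
  by move=> k; have [] := Pf (k.+1, phi k).
suff Hp : csub_set H p.
  by move: missK; rewrite /csub_miss /= -subset0 => /(_ p); exact.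
apply: (lim_out phi (x \o phi)) => // [k|].
  by have [/HKx[]] := phiP k.
apply/cvgrPdist_lt => e e0; near=> k.
have [_] := phiP k; rewrite -ball_normE /= => /lt_trans; apply.
by near: k; exact: near_infty_natSinv_lt (PosNum e0).
Unshelve. all: by end_near. Qed.

Definition conj_by (g : M3) (S : set M3) : set M3 :=
  [set g *m x *m invmx g | x in S].

Definition diag_pos : set M3 :=
  [set a | [/\ is_diag_mx a, forall i, 0 < a i i & \det a = 1]].

Definition upper_triangular : set M3 :=
  [set b | SL3 b /\ forall i j : 'I_3, (j < i)%N -> b i j = 0].

Definition Cartan : set closedSubgroup :=
  [set H : closedSubgroup |
    exists2 g, SL3 g & (H : set M3) = conj_by g diag_pos].

Definition expmx (X : M3) : M3 :=
  limn (series (fun k : nat => (k`!%:R)^-1 *: X ^+ k)).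

Lemma is_cvg_expmx (X : M3) :
  cvgn (series (fun k : nat => (k`!%:R)^-1 *: X ^+ k)).
Proof.
have entry (C : M3) a b : `|C a b| <= `|C|.
  rewrite [leRHS]/Num.Def.normr/= mx_normrE.
  by apply/bigmax_geP; right; exists (a, b).
have norm_mul (A B : M3) : `|A * B| <= 3 * `|A| * `|B|.
  rewrite [leLHS]/Num.Def.normr/= mx_normrE.
  apply: bigmax_le => [|[i j] _] /=; first by rewrite !mulr_ge0.
  rewrite mxE (le_trans (ler_norm_sum _ _ _))//.
  apply: (@le_trans _ _ (\sum_(k < 3) `|A| * `|B|)).
    by apply: ler_sum => k _; rewrite normrM ler_pM.
  by rewrite sumr_const card_ord -mulrA mulr_natl.
have norm_exp k : `|X ^+ k| <= `|1 : M3| * (3 * `|X|) ^+ k.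
  elim: k => [|k IH]; first by rewrite !expr0 mulr1.
  rewrite exprS (le_trans (norm_mul _ _))// exprS mulrCA.
  by rewrite ler_wpM2l// mulr_ge0.
pose c i j (k : nat) := ((k`!%:R)^-1 *: X ^+ k) i j.
have cvg_c i j : cvgn (series (c i j)).
  apply: normed_cvg; apply: (@series_le_cvg _ _
    (fun k => `|1 : M3| *: exp_coeff (3 * `|X|) k)) => [k|k|k|] //=.
  - by rewrite mulr_ge0// exp_coeff_ge0// mulr_ge0.
  - rewrite /c mxE normrM gtr0_norm ?invr_gt0 ?ltr0n ?fact_gt0//.
    rewrite /exp_coeff /= /GRing.scale /= mulrA [leRHS]mulrC.
    by rewrite ler_wpM2l// (le_trans (entry _ _ _)).
  - exact/is_cvg_seriesZ/is_cvg_series_exp_coeff.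
apply/cvg_ex; exists (\matrix_(i, j) limn (series (c i j))).
apply: cvg_mx_coord => i j; rewrite mxE.
under eq_cvg do rewrite summxE.
exact: cvg_c.
Qed.

Definition lie_algebra (H : set M3) : set M3 :=
  [set X | forall t : R, H (expmx (t *: X))].

(* The dimension of a closed subgroup, as a Lie group, is that of its Lie
   algebra. *)
Definition has_dim (H : set M3) (d : nat) : Prop :=
  exists2 V : {vspace M3}, [set X | X \in V] = lie_algebra H & \dim V = d.

Definition abelian_sub (H : set M3) : Prop :=
  forall x y, H x -> H y -> x *m y = y *m x.

Definition in_Borel (H : set M3) : Prop :=
  exists2 g, SL3 g & H `<=` conj_by g upper_triangular.

Definition calA : set closedSubgroup :=
  [set H : closedSubgroup |
    [/\ connected (H : set M3), abelian_sub H, has_dim H 2 & in_Borel H]].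

End subgroups.

(* Main.v *)
From HB Require Import structures.
Require Import Defs.
From mathcomp Require Import all_boot all_order all_algebra.
From mathcomp Require Import all_classical all_reals all_analysis.
From mathcomp Require Import zify ring lra.

Set Implicit Arguments.
Unset Strict Implicit.
Unset Printing Implicit Defensive.

Import Order.TTheory GRing.Theory Num.Theory.
Import numFieldNormedType.Exports.

Local Open Scope classical_set_scope.
Local Open Scope ring_scope.

(** Both sides of the theorem consist of the same groups, which have a linear
    description.  Let C be a commutative space of 3 x 3 matrices that contains
    the identity, has dimension 3 and is upper triangular in the basis given by
    the columns of some g in SL_3 (triAlg g C).  The elements of C that have
    determinant 1 and positive eigenvalues form a closed subgroup posSL g C.  A
    Cartan subgroup is the case where C is a conjugate of the diagonal algebra.

    Everything rests on the bound of Schur: a commuting space of upper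
    triangular 3 x 3 matrices has dimension at most 3 (dim_commuting_upper3).
    Hence C is its own centralizer among the matrices triangular in the frame g
    (triAlgP), so that it is an algebra, and a matrix belongs to C as soon as it
    is a limit of triangular matrices that commute with C in the limit.  This
    makes the groups posSL g C depend continuously on g and C (posSL_lim_in and
    posSL_lim_out).

    The groups posSL g C are the elements of A(SL_3).  Such a group is connected
    because the elements of C with positive eigenvalues form a convex set that
    rescaling maps onto it, and its Lie algebra is the trace zero part of C
    (calA_posSL).  Conversely, for H in A(SL_3) let C be spanned by the identity
    and the Lie algebra of H.  The bound puts H inside posSL g C; a Newton
    iteration for the exponential shows that H contains a neighbourhood of the
    identity in posSL g C, and connectedness gives equality (calA_ex).

    A limit of Cartan subgroups is some posSL g C: the Gram-Schmidt process
    gives an orthogonal triangular frame of each Cartan subgroup and an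
    orthonormal basis of its algebra, and both range over compact sets
    (closure_Cartan_ex).  Conversely, C is the limit of the centralizers of
    triangular matrices with distinct eigenvalues, which are conjugates of the
    diagonal algebra (closure_Cartan_posSL).  If C contains an idempotent e
    other than 0 and 1, it is spanned by 1, e and some x, and x can be perturbed
    within the matrices that commute with e; otherwise C is the sum of the
    scalars and a space of nilpotent matrices, and the approximation is
    explicit. *)

(** * Limits of matrices *)

Section MatrixLimits.
Variables (R : realType) (T : Type) (F : set_system T).
Context {FF : Filter F}.

Lemma cvg_coord m n (f : T -> 'M[R]_(m, n)) (x : 'M[R]_(m, n)) i j :
  f @ F --> x -> f t i j @[t --> F] --> x i j.
Proof. 
move=> fx; apply: (@cvg_comp _ _ _ f (fun M : 'M[R]_(m, n) => M i j) F
  (nbhs x) (nbhs (x i j)) fx).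
exact: coord_continuous. Qed.

Lemma cvg_mulmx m n p (f : T -> 'M[R]_(m, n)) (h : T -> 'M[R]_(n, p))
    (x : 'M[R]_(m, n)) (y : 'M[R]_(n, p)) :
  f @ F --> x -> h @ F --> y -> f t *m h t @[t --> F] --> x *m y.
Proof.
move=> fx hy; apply: cvg_mx_coord => i j; rewrite mxE.
under eq_cvg do rewrite mxE.
apply: cvg_big => [|k _]; first exact: add_continuous.
by apply: cvgM; exact: cvg_coord.
Qed.

Lemma cvg_trmx m n (f : T -> 'M[R]_(m, n)) (x : 'M[R]_(m, n)) :
  f @ F --> x -> (f t)^T @[t --> F] --> x^T.
Proof.
move=> fx; apply: cvg_mx_coord => i j; rewrite mxE.
under eq_cvg do rewrite mxE.
exact: cvg_coord.
Qed.

Lemma cvg_det n (f : T -> 'M[R]_n) (x : 'M[R]_n) :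
  f @ F --> x -> \det (f t) @[t --> F] --> \det x.
Proof.
move=> fx; apply: cvg_big => [|s _]; first exact: add_continuous.
apply: cvgM; first exact: cvg_cst.
by apply: cvg_big => [|i _]; [exact: mul_continuous | exact: cvg_coord].
Qed.

End MatrixLimits.

(** * First order behaviour of the matrix exponential *)

Section MatrixExp.
Variable R : realType.
Local Notation M3 := 'M[R]_3.
Implicit Types X Y : M3.

Lemma norm_coord m n (X : 'M[R]_(m.+1, n.+1)) i j : `|X i j| <= `|X|.
Proof.
rewrite [leRHS]/Num.Def.normr/= mx_normrE.
by apply/bigmax_geP; right; exists (i, j).
Qed.

Lemma normM3 X Y : `|X * Y| <= 3 * `|X| * `|Y|.
Proof.
rewrite [leLHS]/Num.Def.normr/= mx_normrE.
apply: bigmax_le => [|[i j] _] /=; first by rewrite !mulr_ge0.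
rewrite mxE (le_trans (ler_norm_sum _ _ _))//.
apply: (@le_trans _ _ (\sum_(k < 3) `|X| * `|Y|)).
  by apply: ler_sum => k _; rewrite normrM ler_pM// norm_coord.
by rewrite sumr_const card_ord -mulrA mulr_natl.
Qed.

Lemma normX3 X k : `|X ^+ k| <= `|1 : M3| * (3 * `|X|) ^+ k.
Proof.
elim: k => [|k IH]; first by rewrite !expr0 mulr1.
rewrite exprS (le_trans (normM3 _ _))// exprS mulrCA.
by rewrite ler_wpM2l// mulr_ge0.
Qed.

Definition expK : R := `|1 : M3| * expR 3.

(** The tail of the exponential series from degree 2 on is at most |X| ^ 2 times
    the exponential series of 3, where 3 is the constant in the
    submultiplicativity of the sup norm. *)
Lemma expmx_approx X : `|X| <= 1 -> `|expmx X - 1 - X| <= expK * `|X| ^+ 2.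
Proof.
move=> X1.
have cX := @is_cvg_expmx R X.
have bnd n : `|series (fun k : nat => (k`!%:R)^-1 *: X ^+ k) n.+2 - 1 - X|
    <= expK * `|X| ^+ 2.
  rewrite /series /= big_nat_recl// big_nat_recl//= expr0 expr1 !invr1 !scale1r.
  rewrite [1 + _]addrC addrK [X + _]addrC addrK.
  rewrite (le_trans (ler_norm_sum _ _ _))//.
  apply: (@le_trans _ _ (\sum_(0 <= k < n)
      `|1 : M3| * `|X| ^+ 2 * exp_coeff 3 k.+2)).
    apply: ler_sum => k _; rewrite normrZ gtr0_norm ?invr_gt0 ?ltr0n ?fact_gt0//.
    rewrite /exp_coeff /= -[leRHS]mulrA mulrA [leRHS]mulrA [leRHS]mulrC.
    apply: ler_wpM2l; first by rewrite invr_ge0.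
    rewrite (le_trans (normX3 _ _))// -mulrA ler_wpM2l// exprMn mulrC.
    apply: ler_wpM2r; first by rewrite exprn_ge0.
    by rewrite -(addn2 k) exprD ler_piMl// ?exprn_ge0// exprn_ile1.
  rewrite -mulr_sumr /expK mulrAC; apply: ler_wpM2r; first by rewrite exprn_ge0.
  apply: ler_wpM2l => //.
  apply: (@le_trans _ _ (series (exp_coeff 3) n.+2)).
    rewrite /series /= [leRHS]big_nat_recl// [in leRHS]big_nat_recl//=.
    by rewrite addrA ler_wpDl// addr_ge0// exp_coeff_ge0.
  apply: nondecreasing_cvgn_le; last exact: is_cvg_series_exp_coeff.
  by apply: nondecreasing_series => k _ _; exact: exp_coeff_ge0.
have c1 : `|series (fun k : nat => (k`!%:R)^-1 *: X ^+ k) n - 1 - X|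
    @[n --> \oo] --> `|expmx X - 1 - X|.
  apply: cvg_norm; apply: cvgB; last exact: cvg_cst.
  by apply: cvgB; [exact: cX | exact: cvg_cst].
apply: (@closed_cvg _ _ _ _ _ (fun r : R => r <= expK * `|X| ^+ 2) _ _ _ c1).
  exact: closed_le.
near=> n.
have n2 : (1 < n)%N by near: n; exact: nbhs_infty_gt.
by rewrite -(subnK n2) addn2; exact: bnd.
Unshelve. all: by end_near. Qed.

(** Recovers an element of a Lie algebra from its one-parameter group, using
    linear operations and limits only. *)
Lemma cvg_expmx_scaled X :
  n.+1%:R *: (expmx (n.+1%:R^-1 *: X) - 1) @[n --> \oo] --> X.
Proof.
have K0 : 0 < 1 + expK * `|X| ^+ 2.
  by rewrite ltr_wpDr// mulr_ge0 ?exprn_ge0// mulr_ge0// expR_ge0.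
apply/cvgrPdist_le => e e0.
have e1 : 0 < (1 + `|X|)^-1 by rewrite invr_gt0 ltr_wpDr.
have e2 : 0 < e / (1 + expK * `|X| ^+ 2) by rewrite divr_gt0.
near=> n.
have n0 : 0 < n.+1%:R :> R by [].
have small : `|n.+1%:R^-1 *: X| <= 1.
  rewrite normrZ gtr0_norm ?invr_gt0//.
  rewrite -[leRHS](@mulVf _ (1 + `|X|)) ?lt0r_neq0 ?ltr_wpDr//.
  apply: ler_pM => //; last by rewrite lerDr.
  apply/ltW; near: n.
  exact: (near_infty_natSinv_lt (PosNum e1)).
rewrite -[X in X - _](scalerKV (lt0r_neq0 n0)) -scalerBr normrZ gtr0_norm//.
rewrite distrC (le_trans (ler_wpM2l (ltW n0) (expmx_approx small)))//.
rewrite normrZ gtr0_norm ?invr_gt0// exprMn.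
have -> : n.+1%:R * (expK * (n.+1%:R^-1 ^+ 2 * `|X| ^+ 2)) =
  n.+1%:R^-1 * (expK * `|X| ^+ 2) by field.
apply: (@le_trans _ _ (n.+1%:R^-1 * (1 + expK * `|X| ^+ 2))).
  by rewrite ler_wpM2l// ?invr_ge0// lerDr.
rewrite -ler_pdivlMr//; apply/ltW; near: n.
exact: (near_infty_natSinv_lt (PosNum e2)).
Unshelve. all: by end_near. Qed.

End MatrixExp.

(** * Commuting spaces of triangular matrices *)

Section CommutingTriangular.
Variable F : fieldType.

Definition upper n (x : 'M[F]_n) := forall i j : 'I_n, (j < i)%N -> x i j = 0.

Definition commuting n (V : {vspace 'M[F]_n}) :=
  forall x y, x \in V -> y \in V -> x *m y = y *m x.

(** For upper triangular matrices, deleting the last row and column, or the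
    first ones, is a ring morphism. *)
Definition ulblock n (x : 'M[F]_n.+1) : 'M[F]_n := row' ord_max (col' ord_max x).
Definition drblock n (x : 'M[F]_n.+1) : 'M[F]_n := row' ord0 (col' ord0 x).

Lemma ulblock_is_linear n : linear (@ulblock n).
Proof. by move=> a x y; apply/matrixP=> i j; rewrite !mxE. Qed.
Lemma drblock_is_linear n : linear (@drblock n).
Proof. by move=> a x y; apply/matrixP=> i j; rewrite !mxE. Qed.

HB.instance Definition _ n := GRing.isLinear.Build F _ _ _ (@ulblock n)
  (@ulblock_is_linear n).
HB.instance Definition _ n := GRing.isLinear.Build F _ _ _ (@drblock n)
  (@drblock_is_linear n).

Lemma ulblockM n (x y : 'M[F]_n.+1) :
  upper y -> ulblock (x *m y) = ulblock x *m ulblock y.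
Proof.
move=> uy; apply/matrixP => i j; rewrite !mxE big_ord_recr /=.
rewrite [y ord_max _]uy ?lift_max// mulr0 addr0.
apply: eq_bigr => k _; rewrite !mxE.
have -> // : widen_ord (leqnSn n) k = lift ord_max k.
by apply/val_inj/esym; exact: lift_max.
Qed.

Lemma drblockM n (x y : 'M[F]_n.+1) :
  upper x -> drblock (x *m y) = drblock x *m drblock y.
Proof.
move=> ux; apply/matrixP => i j; rewrite !mxE big_ord_recl /=.
rewrite [x _ ord0]ux// mul0r add0r.
by apply: eq_bigr => k _; rewrite !mxE.
Qed.

Lemma upper_ulblock n (x : 'M[F]_n.+1) : upper x -> upper (ulblock x).
Proof. by move=> ux i j ij; rewrite !mxE ux// !lift_max. Qed.

Lemma upper_drblock n (x : 'M[F]_n.+1) : upper x -> upper (drblock x).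
Proof. by move=> ux i j ij; rewrite !mxE ux. Qed.

(** The induction step of Mirzakhani's proof of Schur's bound.  The kernel K1 of
    ulblock on V consists of matrices supported in the last column, the kernel
    K2 of drblock of matrices supported in the first row.  Commutation makes
    these rows orthogonal to these columns, so dim K1 + dim K2 is at most the
    size of the matrices. *)
Lemma dim_commuting_upper_rec n (V : {vspace 'M[F]_n.+2}) :
  commuting V -> (forall x, x \in V -> upper x) ->
  (2 * \dim V <= \dim (linfun (@ulblock n.+1) @: V) +
                 \dim (linfun (@drblock n.+1) @: V) + n.+2)%N.
Proof.
move=> cV uV.
pose K1 := (V :&: lker (linfun (@ulblock n.+1)))%VS.
pose K2 := (V :&: lker (linfun (@drblock n.+1)))%VS.
have dim1 := limg_ker_dim (linfun (@ulblock n.+1)) V.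
have dim2 := limg_ker_dim (linfun (@drblock n.+1)) V.
suff : (\dim K1 + \dim K2 <= n.+2)%N.
  move: dim1 dim2; rewrite -/K1 -/K2 => dim1 dim2 k12.
  by rewrite mul2n -addnn -{1}dim1 -dim2 addnACA addnC leq_add2l.
have K1P x : x \in K1 -> x \in V /\ forall i j, j != ord_max -> x i j = 0.
  rewrite memv_cap memv_ker lfunE => /andP[xV /eqP/matrixP x0]; split=> // i j.
  case: (unliftP ord_max j) => [j' ->|->]; last by rewrite eqxx.
  case: (unliftP ord_max i) => [i' ->|->] _; last first.
    by apply: (uV x xV); rewrite lift_max ltn_ord.
  by have := x0 i' j'; rewrite !mxE.
have K2P x : x \in K2 -> x \in V /\ forall i j, i != ord0 -> x i j = 0.
  rewrite memv_cap memv_ker lfunE => /andP[xV /eqP/matrixP x0]; split=> // i j.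
  case: (unliftP ord0 i) => [i' ->|->]; last by rewrite eqxx.
  case: (unliftP ord0 j) => [j' ->|->] _; last by rewrite (uV x xV).
  by have := x0 i' j'; rewrite !mxE.
pose A := \matrix_(i < \dim K1, j < n.+2) (vbasis K1)`_i j ord_max.
pose B := \matrix_(i < n.+2, j < \dim K2) (vbasis K2)`_j ord0 i.
have memb (K : {vspace 'M[F]_n.+2}) (i : 'I_(\dim K)) : (vbasis K)`_i \in K.
  by apply: vbasis_mem; rewrite mem_nth// size_tuple.
have AB0 : A *m B = 0.
  apply/matrixP => i j; rewrite !mxE.
  have [aV a0] := K1P _ (memb K1 i).
  have [bV b0] := K2P _ (memb K2 j).
  have /matrixP/(_ ord0 ord_max) := cV _ _ bV aV.
  rewrite !mxE => ba.
  transitivity (\sum_k (vbasis K2)`_j ord0 k * (vbasis K1)`_i k ord_max).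
    by apply: eq_bigr => k _; rewrite !mxE mulrC.
  rewrite ba big1// => k _.
  have [->|km] := eqVneq k ord_max; first by rewrite b0// mulr0.
  by rewrite a0// mul0r.
have rA : \rank A = \dim K1.
  apply/eqP; apply: inj_row_free => v vA.
  have /freeP indep := basis_free (vbasisP K1).
  apply/rowP => i; rewrite mxE.
  apply: (indep (fun i => v ord0 i)) i.
  have sK : \sum_(i < \dim K1) v ord0 i *: (vbasis K1)`_i \in K1.
    by apply: memv_suml => i _; apply: memvZ; exact: memb.
  have [_ s0] := K1P _ sK.
  apply/matrixP => i j; rewrite [RHS]mxE.
  have [->|/s0->//] := eqVneq j ord_max.
  have /rowP/(_ i) := vA; rewrite !mxE => <-.
  by rewrite summxE; apply: eq_bigr => k _; rewrite !mxE.
have rB : \rank B = \dim K2.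
  rewrite -mxrank_tr; apply/eqP; apply: inj_row_free => v vB.
  have /freeP indep := basis_free (vbasisP K2).
  apply/rowP => i; rewrite mxE.
  apply: (indep (fun i => v ord0 i)) i.
  have sK : \sum_(i < \dim K2) v ord0 i *: (vbasis K2)`_i \in K2.
    by apply: memv_suml => i _; apply: memvZ; exact: memb.
  have [_ s0] := K2P _ sK.
  apply/matrixP => i j; rewrite [RHS]mxE.
  have [->|/s0->//] := eqVneq i ord0.
  have /rowP/(_ j) := vB; rewrite !mxE => <-.
  by rewrite summxE; apply: eq_bigr => k _; rewrite !mxE.
by rewrite -rA -rB; exact: mulmx0_rank_max.
Qed.

Lemma commuting_ulblock n (V : {vspace 'M[F]_n.+1}) :
  commuting V -> (forall x, x \in V -> upper x) ->
  commuting (linfun (@ulblock n) @: V)%VS /\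
  forall x, x \in (linfun (@ulblock n) @: V)%VS -> upper x.
Proof.
move=> cV uV; split=> [_ _ /memv_imgP[x xV ->] /memv_imgP[y yV ->]|].
  rewrite !lfunE /= -(ulblockM x (uV y yV)) (cV x y xV yV) ulblockM//.
  exact: uV.
by move=> _ /memv_imgP[x xV ->]; rewrite lfunE /=; exact/upper_ulblock/uV.
Qed.

Lemma commuting_drblock n (V : {vspace 'M[F]_n.+1}) :
  commuting V -> (forall x, x \in V -> upper x) ->
  commuting (linfun (@drblock n) @: V)%VS /\
  forall x, x \in (linfun (@drblock n) @: V)%VS -> upper x.
Proof.
move=> cV uV; split=> [_ _ /memv_imgP[x xV ->] /memv_imgP[y yV ->]|].
  rewrite !lfunE /= -(drblockM y (uV x xV)) (cV x y xV yV) drblockM//.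
  exact: uV.
by move=> _ /memv_imgP[x xV ->]; rewrite lfunE /=; exact/upper_drblock/uV.
Qed.

(** Schur's bound in size 3: the recursion bounds the dimension by 1 in size 1,
    then 2 in size 2, and twice the dimension by 7 in size 3. *)
Lemma dim_commuting_upper3 (V : {vspace 'M[F]_3}) :
  commuting V -> (forall x, x \in V -> upper x) -> (\dim V <= 3)%N.
Proof.
have dim1 (W : {vspace 'M[F]_1}) : (\dim W <= 1)%N.
  by rewrite (leq_trans (dimvS (subvf W)))// dimvf /dim /= muln1.
have dim2 (W : {vspace 'M[F]_2}) :
    commuting W -> (forall x, x \in W -> upper x) -> (\dim W <= 2)%N.
  move=> cW uW; have := dim_commuting_upper_rec cW uW.
  move=> /leq_trans/(_ (leq_add (leq_add (dim1 _) (dim1 _)) (leqnn _))).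
  by move: (\dim W) => d; lia.
move=> cV uV; have := dim_commuting_upper_rec cV uV.
have [c1 u1] := commuting_ulblock cV uV.
have [c2 u2] := commuting_drblock cV uV.
move=> /leq_trans/(_ (leq_add (leq_add (dim2 _ c1 u1) (dim2 _ c2 u2)) (leqnn _))).
by move: (\dim V) => d; lia.
Qed.

Lemma upperM n (x y : 'M[F]_n) : upper x -> upper y -> upper (x *m y).
Proof.
move=> ux uy i j ij; rewrite mxE big1// => k _.
have [ki|ik] := ltnP k i; first by rewrite ux// mul0r.
by rewrite uy ?mulr0//; exact: leq_trans ij ik.
Qed.

Lemma upper_diagM n (x y : 'M[F]_n) i :
  upper x -> upper y -> (x *m y) i i = x i i * y i i.
Proof.
move=> ux uy; rewrite mxE (bigD1 i)//= big1 ?addr0// => k ki.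
have [lt|gt|/val_inj kE] := ltngtP k i; last by rewrite kE eqxx in ki.
  by rewrite ux// mul0r.
by rewrite uy// mulr0.
Qed.

Lemma det_upper n (x : 'M[F]_n) : upper x -> \det x = \prod_i x i i.
Proof.
move=> ux; rewrite -det_tr det_trig; first by apply: eq_bigr => i _; rewrite mxE.
by apply/is_trig_mxP => i j ij; rewrite mxE ux.
Qed.

End CommutingTriangular.

Lemma upper_invmx (F : fieldType) n (x : 'M[F]_n) :
  x \in unitmx -> upper x -> upper (invmx x).
Proof.
move=> ux tx.
have d0 i : x i i != 0.
  by move: ux; rewrite unitmxE unitfE det_upper// => /prodf_neq0; exact.
suff H k (i j : 'I_n) : (n - i <= k)%N -> (j < i)%N -> invmx x i j = 0.
  by move=> i j; exact: (H (n - i)%N).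
elim: k i j => [|k IH] i j ik ji; first by have := ltn_ord i; lia.
have /matrixP/(_ i j) := mulmxV ux; rewrite !mxE (bigD1 i)//= big1.
  rewrite addr0 (_ : (i == j) = false) /=; last by rewrite -val_eqE /=; lia.
  by move=> /eqP; rewrite mulf_eq0 (negbTE (d0 i)) => /eqP.
move=> l li; have [lti|ltl|/val_inj lE] := ltngtP l i.
- by rewrite tx// mul0r.
- by rewrite (IH l j) ?mulr0//; [lia|exact: ltn_trans ji ltl].
- by rewrite lE eqxx in li.
Qed.

(** * Triangular frames and their diagonal characters *)

Section Frames.
Variable R : realType.
Local Notation M3 := 'M[R]_3.
Implicit Types (g x y X : M3) (C : {vspace M3}).

(** The matrix of x in the basis formed by the columns of g. *)
Definition fr g x : M3 := invmx g *m x *m g.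

Lemma fr_is_linear g : linear (fr g).
Proof. by move=> a x y; rewrite /fr mulmxDr mulmxDl -scalemxAr -scalemxAl. Qed.

HB.instance Definition _ g := GRing.isLinear.Build R _ _ _ (fr g)
  (@fr_is_linear g).

Lemma SL3_unit g : SL3 g -> g \in unitmx.
Proof. by rewrite /SL3 /= unitmxE => ->; exact: unitr1. Qed.

Lemma frM g x y : g \in unitmx -> fr g (x *m y) = fr g x *m fr g y.
Proof. by move=> ug; rewrite /fr !mulmxA mulmxK. Qed.

Lemma fr1 g : g \in unitmx -> fr g 1%:M = 1%:M.
Proof. by move=> ug; rewrite /fr mulmx1 mulVmx. Qed.

Lemma frK g x : g \in unitmx -> g *m fr g x *m invmx g = x.
Proof. by move=> ug; rewrite /fr !mulmxA mulmxV// mul1mx mulmxK. Qed.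

Lemma frKV g x : g \in unitmx -> fr g (g *m x *m invmx g) = x.
Proof. by move=> ug; rewrite /fr !mulmxA mulVmx// mul1mx mulmxKV. Qed.

Lemma fr_inj g : g \in unitmx -> injective (fr g).
Proof. by move=> ug x y xy; rewrite -(frK x ug) xy frK. Qed.

Lemma det_fr g x : g \in unitmx -> \det (fr g x) = \det x.
Proof.
by move=> ug; rewrite /fr !det_mulmx mulrAC -det_mulmx mulVmx// det1 mul1r.
Qed.

Lemma tr_fr g x : g \in unitmx -> \tr (fr g x) = \tr x.
Proof. by move=> ug; rewrite /fr mxtrace_mulC mulmxA mulmxV// mul1mx. Qed.

Definition tri g x := upper (fr g x).
(** On the matrices that are triangular in the frame g these are three
    characters; their values are the eigenvalues. *)
Definition chi g (i : 'I_3) x := fr g x i i.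

Lemma chiM g i x y : g \in unitmx -> tri g x -> tri g y ->
  chi g i (x *m y) = chi g i x * chi g i y.
Proof. by move=> ug tx ty; rewrite /chi frM// upper_diagM. Qed.

Lemma chi1 g i : g \in unitmx -> chi g i 1%:M = 1.
Proof. by move=> ug; rewrite /chi fr1// mxE eqxx. Qed.

Lemma chiD g i x y : chi g i (x + y) = chi g i x + chi g i y.
Proof. by rewrite /chi raddfD mxE. Qed.

Lemma chiZ g i a x : chi g i (a *: x) = a * chi g i x.
Proof. by rewrite /chi linearZ mxE. Qed.

Lemma triM g x y : g \in unitmx -> tri g x -> tri g y -> tri g (x *m y).
Proof. by move=> ug tx ty; rewrite /tri frM//; exact: upperM. Qed.

Lemma tri1 g : g \in unitmx -> tri g 1%:M.
Proof. by move=> ug i j ij; rewrite fr1// mxE -val_eqE gtn_eqF. Qed.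

Lemma triD g x y : tri g x -> tri g y -> tri g (x + y).
Proof. by move=> tx ty i j ij; rewrite raddfD mxE tx ?ty ?addr0. Qed.

Lemma triZ g a x : tri g x -> tri g (a *: x).
Proof. by move=> tx i j ij; rewrite linearZ mxE tx ?mulr0. Qed.

Lemma det_tri g x : g \in unitmx -> tri g x -> \det x = \prod_i chi g i x.
Proof. by move=> ug tx; rewrite -(det_fr x ug) det_upper. Qed.

Lemma trace_tri g x : g \in unitmx -> \tr x = \sum_i chi g i x.
Proof. by move=> ug; rewrite -(tr_fr x ug). Qed.

Lemma fr_invmx g x : g \in unitmx -> x \in unitmx ->
  fr g (invmx x) = invmx (fr g x).
Proof.
move=> ug ux; apply: (can_inj (mulKmx (_ : fr g x \in unitmx))).
  by rewrite unitmxE det_fr.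
by rewrite mulmxV ?unitmxE ?det_fr// -frM// mulmxV// fr1.
Qed.

Lemma tri_invmx g x : g \in unitmx -> x \in unitmx -> tri g x -> tri g (invmx x).
Proof.
move=> ug ux tx; rewrite /tri fr_invmx//; apply: upper_invmx => //.
by rewrite unitmxE det_fr.
Qed.

Lemma chi_invmx g i x : g \in unitmx -> x \in unitmx -> tri g x ->
  chi g i (invmx x) = (chi g i x)^-1.
Proof.
move=> ug ux tx.
have := chiM i ug tx (tri_invmx ug ux tx); rewrite mulmxV// chi1//.
have [->|c0 ic] := eqVneq (chi g i x) 0.
  by rewrite mul0r => /eqP; rewrite oner_eq0.
by rewrite -[LHS](mulKf c0) -ic mulr1.
Qed.

Section Limits.
Variables (T : Type) (F : set_system T).
Context {FF : ProperFilter F}.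

Lemma cvg_fr (gt f : T -> M3) g x : gt @ F --> g ->
  (fun t => invmx (gt t)) @ F --> invmx g -> f @ F --> x ->
  (fun t => fr (gt t) (f t)) @ F --> fr g x.
Proof. by move=> gg ig fx; apply: cvg_mulmx => //; exact: cvg_mulmx. Qed.

Lemma cvg_chi (gt f : T -> M3) g x i : gt @ F --> g ->
  (fun t => invmx (gt t)) @ F --> invmx g -> f @ F --> x ->
  (fun t => chi (gt t) i (f t)) @ F --> chi g i x.
Proof. by move=> gg ig fx; apply: cvg_coord; exact: cvg_fr. Qed.

Lemma cvg_eq0 (f : T -> R) a :
  f @ F --> a -> (\forall t \near F, f t = 0) -> a = 0.
Proof.
move=> fa f0; apply: (@closed_cvg _ _ _ _ f (fun r : R => r = 0)) fa => //.
Qed.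

(** The frame is allowed to move.  Convergence of the inverse frames is required
    separately, which avoids continuity of matrix inversion. *)
Lemma tri_cvg (gt f : T -> M3) g x : gt @ F --> g ->
  (fun t => invmx (gt t)) @ F --> invmx g -> f @ F --> x ->
  (\forall t \near F, tri (gt t) (f t)) -> tri g x.
Proof.
move=> gg ig fx tf i j ij; apply: (@cvg_eq0 (fun t => fr (gt t) (f t) i j)).
  by apply: cvg_coord; exact: cvg_fr.
by apply: filterS tf => t /(_ i j ij).
Qed.

Lemma commute_cvg (f h : T -> M3) x y : f @ F --> x -> h @ F --> y ->
  (\forall t \near F, f t *m h t = h t *m f t) -> x *m y = y *m x.
Proof.
move=> fx hy fh; apply/eqP; rewrite -subr_eq0; apply/eqP/matrixP => i j.
rewrite [RHS]mxE; apply: (@cvg_eq0 (fun t => (f t *m h t - h t *m f t) i j)).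
  by apply: cvg_coord; apply: cvgB; exact: cvg_mulmx.
by apply: filterS fh => t ->; rewrite subrr mxE.
Qed.

End Limits.

(** * Maximal commutative triangular algebras *)

(** A space of matrices; that it is closed under products follows, by triAlgM. *)
Record triAlg g C : Prop := TriAlg {
  triAlg_SL : SL3 g;
  triAlg_tri : forall x, x \in C -> tri g x;
  triAlg_1 : 1%:M \in C;
  triAlg_comm : commuting C;
  triAlg_dim : \dim C = 3%N }.

Lemma commuting_addl C x : commuting C ->
  (forall c, c \in C -> x *m c = c *m x) -> commuting (C + <[x]>)%VS.
Proof.
move=> cC xC y z /memv_addP[c cC1 [_ /vlineP[a ->] ->]].
move=> /memv_addP[d dC1 [_ /vlineP[b ->] ->]].
rewrite !mulmxDl !mulmxDr (cC c d)// -!scalemxAl -!scalemxAr.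
by rewrite (xC c)// (xC d)// !scalerA [b * a]mulrC addrACA.
Qed.

(** A matrix that is triangular in the frame and commutes with C spans together
    with C a commuting triangular space, which by Schur's bound is not larger
    than C. *)
Lemma triAlgP g C x : triAlg g C ->
  x \in C <-> tri g x /\ forall c, c \in C -> x *m c = c *m x.
Proof.
move=> [sg tC C1 cC dC]; split=> [xC|[tx xc]].
  by split=> [|c cC1]; [exact: tC | exact: cC].
have ug := SL3_unit sg.
pose V := (C + <[x]>)%VS.
have cV : commuting V := commuting_addl cC xc.
have tV y : y \in V -> tri g y.
  move=> /memv_addP[c cC1 [_ /vlineP[b ->] ->]].
  by apply: triD; [exact: tC | exact: triZ].
have := @dim_commuting_upper3 _ (linfun (fr g) @: V)%VS.
rewrite limg_dim_eq; last first.
  apply/eqP; rewrite -subv0; apply/subvP => y; rewrite memv_cap memv_ker memv0.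
  rewrite lfunE => /andP[_ /eqP fy]; apply/eqP/(fr_inj ug).
  by rewrite fy linear0.
move=> dV.
have {}dV : (\dim V <= 3)%N.
  apply: dV => [_ _ /memv_imgP[y yV ->] /memv_imgP[z zV ->]|].
    by rewrite !lfunE /= -!frM// (cV y z).
  by move=> _ /memv_imgP[y yV ->]; rewrite lfunE /=; exact: tV.
have /eqP CV : C == V by rewrite -(geq_leqif (dimv_leqif_eq (addvSl _ _))) dC.
by rewrite CV; apply: (subvP (addvSr C <[x]>)); exact: memv_line.
Qed.

Lemma triAlgM g C x y : triAlg g C -> x \in C -> y \in C -> x *m y \in C.
Proof.
move=> aC xC yC; have [sg tC _ cC _] := aC; have ug := SL3_unit sg.
apply/(triAlgP _ aC); split=> [|c cC1].
  by apply: triM => //; exact: tC.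
by rewrite -mulmxA (cC y c)// mulmxA (cC x c)// mulmxA.
Qed.

Lemma triAlgV g C x : triAlg g C -> x \in unitmx -> x \in C -> invmx x \in C.
Proof.
move=> aC ux xC; have [sg tC _ cC _] := aC; have ug := SL3_unit sg.
apply/(triAlgP _ aC); split=> [|c cC1].
  by apply: tri_invmx => //; exact: tC.
apply: (can_inj (mulKmx ux)); apply: (can_inj (mulmxK ux)).
by rewrite mulmxA mulmxV// mul1mx mulmxA mulmxKV// -cC.
Qed.

(** C is the solution set of closed conditions by triAlgP. *)
Lemma triAlg_cvg g C (T : Type) (F : set_system T) (f : T -> M3) x :
  triAlg g C -> ProperFilter F -> f @ F --> x ->
  (\forall t \near F, f t \in C) -> x \in C.
Proof.
move=> aC FF fx fC; apply/(triAlgP _ aC); split=> [|c cC1].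
  apply: (@tri_cvg _ F _ (fun=> g) f g x) => //; try exact: cvg_cst.
  by apply: filterS fC => t /(triAlg_tri aC).
apply: (@commute_cvg _ F _ f (fun=> c)) => //; first exact: cvg_cst.
by apply: filterS fC => t tC; exact: (triAlg_comm aC).
Qed.

Lemma expmx_triAlg g C X : triAlg g C -> X \in C -> expmx X \in C.
Proof.
move=> aC XC.
apply: (@triAlg_cvg _ _ _ _ _ _ aC _ (@is_cvg_expmx R X)).
apply: nearW => n; apply: memv_suml => k _; apply: memvZ.
elim: k => [|k IH]; first by rewrite expr0; exact: triAlg_1 aC.
by rewrite exprS; exact: triAlgM aC _ _.
Qed.

Lemma triX g X k : g \in unitmx -> tri g X -> tri g (X ^+ k).
Proof.
move=> ug tX; elim: k => [|k IH]; first exact: tri1.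
by rewrite exprS; apply: triM.
Qed.

Lemma tri_expmx g X : g \in unitmx -> tri g X -> tri g (expmx X).
Proof.
move=> ug tX.
apply: (@tri_cvg _ \oo _ (fun=> g) _ g _ _ _ (@is_cvg_expmx R X));
  try exact: cvg_cst.
apply: nearW => n; rewrite /series /=; elim/big_rec: _ => [|k y _ ty].
  by move=> i j ij; rewrite linear0 mxE.
by apply: triD => //; apply/triZ/triX.
Qed.

Lemma chi_expmx g i X : g \in unitmx -> tri g X ->
  chi g i (expmx X) = expR (chi g i X).
Proof.
move=> ug tX.
have c1 : (fun n => chi g i (series (fun k : nat => (k`!%:R)^-1 *: X ^+ k) n))
    @ \oo --> chi g i (expmx X).
  apply: (@cvg_chi _ \oo _ (fun=> g)); try exact: cvg_cst.
  exact: (@is_cvg_expmx R X).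
have c2 : series (exp_coeff (chi g i X)) @ \oo --> expR (chi g i X).
  exact: is_cvg_series_exp_coeff.
apply: (cvg_unique _ c1); first exact: norm_hausdorff.
rewrite (_ : (fun n => _) = series (exp_coeff (chi g i X)))//.
apply/funext => n; rewrite /series /= /chi raddf_sum summxE.
apply: eq_bigr => k _; rewrite -[LHS]/(chi g i (k`!%:R^-1 *: X ^+ k)) chiZ.
rewrite -[fr g X i i]/(chi g i X) /exp_coeff /= mulrC.
congr (_ / _); elim: k => [|k IH]; first by rewrite !expr0 chi1.
by rewrite !exprS -IH; apply: chiM => //; exact: triX.
Qed.

Lemma det_expmx g X : g \in unitmx -> tri g X -> \det (expmx X) = expR (\tr X).
Proof.
move=> ug tX; rewrite (det_tri ug (tri_expmx ug tX)) (trace_tri X ug) expR_sum.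
by apply: eq_bigr => i _; rewrite chi_expmx.
Qed.

(** The determinant and the eigenvalues of an element of C are read off from the
    characters of the frame. *)
Definition posSL g C : set M3 :=
  [set x | [/\ x \in C, \det x = 1 & forall i, 0 < chi g i x]].

End Frames.

(** * The groups of positive unimodular elements *)

Section PositiveParts.
Variable R : realType.
Local Notation M3 := 'M[R]_3.
Implicit Types (g x y X : M3) (C : {vspace M3}).

(** x divided by the real cube root of its determinant. *)
Definition unimodular x : M3 := expR (- ln (\det x) / 3) *: x.

Lemma posSL_unimodular g C x : triAlg g C -> x \in C ->
  (forall i, 0 < chi g i x) -> posSL g C (unimodular x).
Proof.
move=> aC xC x0; have [sg tC _ _ _] := aC; have ug := SL3_unit sg.
have d0 : 0 < \det x by rewrite (det_tri ug (tC _ xC)) prodr_gt0.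
split=> [||i]; first exact: memvZ.
  rewrite detZ -expRM_natr mulfVK// expRN lnK ?posrE// mulVf// gt_eqF//.
by rewrite chiZ mulr_gt0 ?expR_gt0.
Qed.

Lemma unimodular_id x : \det x = 1 -> unimodular x = x.
Proof. by move=> d1; rewrite /unimodular d1 ln1 oppr0 mul0r expR0 scale1r. Qed.

Lemma cvg_unimodular (T : Type) (F : set_system T) (f : T -> M3) x :
  Filter F -> f @ F --> x -> 0 < \det x ->
  (fun t => unimodular (f t)) @ F --> unimodular x.
Proof.
move=> FF fx d0; apply: cvgZ => //.
apply: (@continuous_cvg _ _ _ F FF (fun t => - ln (\det (f t)) / 3) expR).
  exact: continuous_expR.
apply: cvgM; last exact: cvg_cst.
apply: cvgN; apply: (@continuous_cvg _ _ _ F FF (fun t => \det (f t)) (@ln R)).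
  exact: continuous_ln.
exact: cvg_det.
Qed.

Section Limits.
Variables (T : Type) (F : set_system T).
Context {FF : ProperFilter F}.
Variables (gt : T -> M3) (Ct : T -> {vspace M3}) (g : M3) (C : {vspace M3}).
Hypotheses (gtg : gt @ F --> g) (igtg : (fun t => invmx (gt t)) @ F --> invmx g).
Hypotheses (aC : triAlg g C) (aCt : \forall t \near F, triAlg (gt t) (Ct t)).
Hypothesis CtC : forall c, c \in C ->
  exists2 f : T -> M3, (\forall t \near F, f t \in Ct t) & f @ F --> c.

(** Approximants in the algebras have positive eigenvalues eventually; rescaling
    them to determinant 1 does not change the limit. *)
Lemma posSL_lim_in h : posSL g C h ->
  exists2 f : T -> M3, (\forall t \near F, posSL (gt t) (Ct t) (f t)) &
    f @ F --> h.
Proof.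
move=> [hC h1 hpos]; have [f fC fh] := CtC hC.
exists (fun t => unimodular (f t)); last first.
  by rewrite -[X in _ --> X](unimodular_id h1); apply: cvg_unimodular;
    rewrite ?h1.
have fpos i : \forall t \near F, 0 < chi (gt t) i (f t).
  by apply: (cvgr_gt _ (cvg_chi (i := i) gtg igtg fh)); exact: hpos.
near=> t; apply: posSL_unimodular; [near: t; exact: aCt|near: t; exact: fC|].
by near: t; exact: filter_forall fpos.
Unshelve. all: by end_near. Qed.

(** The limit commutes with limits of elements of the algebras, hence with C, so
    triAlgP applies.  Its eigenvalues are nonnegative as limits and nonzero
    because their product is 1. *)
Lemma posSL_lim_out (f : T -> M3) h :
  (\forall t \near F, posSL (gt t) (Ct t) (f t)) -> f @ F --> h -> posSL g C h.
Proof.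
move=> fP fh; have [sg tC _ _ _] := aC; have ug := SL3_unit sg.
have th : tri g h.
  apply: (tri_cvg gtg igtg fh); near=> t.
  have [ft _ _] : posSL (gt t) (Ct t) (f t) by near: t; exact: fP.
  have at_ : triAlg (gt t) (Ct t) by near: t; exact: aCt.
  exact: triAlg_tri at_ _ ft.
have hC : h \in C.
  apply/(triAlgP _ aC); split=> // c /CtC[k kC kc].
  apply: (commute_cvg fh kc); near=> t.
  have [ft _ _] : posSL (gt t) (Ct t) (f t) by near: t; exact: fP.
  have at_ : triAlg (gt t) (Ct t) by near: t; exact: aCt.
  by apply: (triAlg_comm at_ ft); near: t; exact: kC.
have h1 : \det h = 1.
  apply/eqP; rewrite -subr_eq0; apply/eqP.
  apply: (@cvg_eq0 _ _ F _ (fun t => \det (f t) - 1)).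
    by apply: cvgB; [exact: cvg_det | exact: cvg_cst].
  by apply: filterS fP => t [_ -> _]; rewrite subrr.
split=> // i.
have := h1; rewrite (det_tri ug th) => c1.
rewrite lt_neqAle; apply/andP; split.
  have : \prod_i chi g i h != 0 by rewrite c1 oner_eq0.
  by move=> /prodf_neq0/(_ i isT); rewrite eq_sym.
apply: (cvgr_to_ge (cvg_chi (i := i) gtg igtg fh)).
by apply: filterS fP => t [_ _ /(_ i)/ltW].
Unshelve. all: by end_near. Qed.

End Limits.

Lemma closed_posSL g C : triAlg g C -> closed (posSL g C).
Proof.
move=> aC h; rewrite closureEcvg => -[G PG [Gh GC]].
apply: (@posSL_lim_out _ G PG (fun=> g) (fun=> C) g C _ _ aC _ _ id) => //.
- exact: cvg_cst.
- exact: cvg_cst.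
- exact: nearW.
- by move=> c cC; exists (fun=> c); [exact: nearW|exact: cvg_cst].
- exact: GC.
Qed.

Lemma posSL1 g C : triAlg g C -> posSL g C 1%:M.
Proof.
move=> aC; have ug := SL3_unit (triAlg_SL aC).
by split=> [||i]; [exact: triAlg_1 aC|exact: det1|rewrite chi1].
Qed.

Lemma posSLM g C x y : triAlg g C -> posSL g C x -> posSL g C y ->
  posSL g C (x *m y).
Proof.
move=> aC [xC x1 x0] [yC y1 y0]; have ug := SL3_unit (triAlg_SL aC).
split=> [||i]; first exact: triAlgM aC _ _.
  by rewrite det_mulmx x1 y1 mulr1.
by rewrite chiM// ?mulr_gt0//; exact: (triAlg_tri aC).
Qed.

Lemma posSLV g C x : triAlg g C -> posSL g C x -> posSL g C (invmx x).
Proof.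
move=> aC [xC x1 x0]; have ug := SL3_unit (triAlg_SL aC).
have ux := SL3_unit x1.
split=> [||i]; first exact: triAlgV aC _ _.
  by rewrite det_inv x1 invr1.
by rewrite chi_invmx// ?invr_gt0//; exact: (triAlg_tri aC).
Qed.

Lemma posSL_subgroup g C : triAlg g C -> is_closed_subgroup (posSL g C).
Proof.
move=> aC; split; first by move=> x [].
- exact: closed_posSL.
- exact: posSL1.
- by move=> x y; exact: posSLM.
- by move=> x; exact: posSLV.
Qed.

(** Every element is joined to the identity by the rescaled segment, since the
    elements of C with positive eigenvalues form a convex set. *)
Lemma connected_posSL g C : triAlg g C -> connected (posSL g C).
Proof.
move=> aC; have [sg tC C1 _ _] := aC; have ug := SL3_unit sg.
pose path x (s : R) := unimodular ((1 - s) *: 1%:M + s *: x).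
have pos x s i : posSL g C x -> 0 <= s <= 1 ->
    0 < chi g i ((1 - s) *: 1%:M + s *: x).
  move=> [_ _ x0] /andP[s0 s1]; rewrite chiD !chiZ chi1// mulr1.
  have [->|sn1] := eqVneq s 1; first by rewrite subrr add0r mul1r.
  by rewrite ltr_pwDl ?subr_gt0 ?lt_neqAle ?sn1// mulr_ge0// ltW.
have mem x s : posSL g C x -> (1 - s) *: 1%:M + s *: x \in C.
  by move=> [xC _ _]; apply: memvD; exact: memvZ.
have -> : posSL g C = \bigcup_(x in posSL g C) (path x @` `[0, 1]).
  apply/seteqP; split=> [x Px|_ [x Px [s s01 <-]]].
    exists x => //; exists 1; first by rewrite /= in_itv/= ler01 lexx.
    rewrite /path subrr scale0r scale1r add0r unimodular_id//.
    by case: Px.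
  apply: posSL_unimodular => // [|i]; first exact: mem.
  by apply: pos => //; move: s01; rewrite /= in_itv.
apply: bigcup_connected => [|x Px].
  exists 1%:M => x Px; exists 0; first by rewrite /= in_itv/= ler01 lexx.
  by rewrite /path subr0 scale0r scale1r addr0 unimodular_id// det1.
apply: connected_continuous_connected.
  exact/connected_intervalP/interval_is_interval.
apply: continuous_in_subspaceT => s; rewrite inE /= in_itv /= => s01.
apply: cvg_unimodular.
  apply: cvgD; apply: cvgZ; try exact: cvg_cst; last exact: cvg_id.
  by apply: cvgB; [exact: cvg_cst | exact: cvg_id].
rewrite (det_tri ug (tC _ (mem x s Px))) prodr_gt0// => i _.
exact: pos.
Qed.

(** Transfers a linear closed property W of the differences h - 1, h in H, to the
    Lie algebra of H: X is a limit of elements that satisfy W. *)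
Lemma lie_algebra_cvg (H : set M3) (W : set M3) X : lie_algebra H X ->
  (forall h (a : R), H h -> W (a *: (h - 1))) ->
  exists2 u : nat -> M3, (forall n, W (u n)) & u @ \oo --> X.
Proof.
move=> HX HW; exists (fun n => n.+1%:R *: (expmx (n.+1%:R^-1 *: X) - 1)).
  by move=> n; apply: HW; exact: HX.
exact: cvg_expmx_scaled.
Qed.

(** The eigenvalues of exp X are the exponentials of those of X, so they are
    positive, and the determinant is 1 exactly when the trace vanishes. *)
Lemma lie_algebra_posSL g C X : triAlg g C ->
  lie_algebra (posSL g C) X <-> X \in C /\ \tr X = 0.
Proof.
move=> aC; have [sg tC C1 _ _] := aC; have ug := SL3_unit sg.
split=> [LX|[XC X0] t].
  have XC : X \in C.
    have [|u uC uX] := @lie_algebra_cvg _ [set x | x \in C] X LX.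
      by move=> h a [hC _ _] /=; apply: memvZ; exact: memvB.
    by apply: (triAlg_cvg aC _ uX); exact: nearW.
  split=> //; have [_ + _] := LX 1.
  rewrite scale1r (det_expmx ug (tC _ XC)) -expR0 => /expR_inj//.
have tXC : t *: X \in C by exact: memvZ.
split=> [||i]; first exact: expmx_triAlg aC _.
  by rewrite (det_expmx ug (tC _ tXC)) mxtraceZ X0 mulr0 expR0.
by rewrite chi_expmx ?expR_gt0//; exact: tC.
Qed.

(** The trace is a nonzero linear form on C, because C contains the identity. *)
Lemma has_dim_posSL g C : triAlg g C -> has_dim (posSL g C) 2.
Proof.
move=> aC.
pose tr : 'Hom(M3, R^o) := linfun (fun x : M3 => \tr x : R^o).
exists (C :&: lker tr)%VS.
  apply/seteqP; split=> X /=; rewrite memv_cap memv_ker lfunE /=.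
    by move=> /andP[XC /eqP X0]; apply/(lie_algebra_posSL _ aC).
  by move=> /(lie_algebra_posSL _ aC)[-> ->]; rewrite eqxx.
have := limg_ker_dim tr C; rewrite (triAlg_dim aC).
suff -> : (\dim (tr @: C))%N = 1%N by move=> /eqP; rewrite addn1 eqSS => /eqP.
have le1 : (\dim (tr @: C) <= 1)%N.
  by rewrite (leq_trans (dimvS (subvf _)))// dimvf.
apply/eqP; rewrite eqn_leq le1.
rewrite lt0n dimv_eq0; apply/negP => /eqP C0.
have : tr 1%:M \in (tr @: C)%VS by rewrite memv_img// (triAlg_1 aC).
by rewrite C0 memv0 lfunE /= mxtrace1 pnatr_eq0.
Qed.

Lemma calA_posSL g C (H : closedSubgroup R) : triAlg g C ->
  (H : set M3) = posSL g C -> calA H.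
Proof.
move=> aC HE; split; rewrite HE.
- exact: connected_posSL aC.
- by move=> x y [xC _ _] [yC _ _]; exact: (triAlg_comm aC).
- exact: has_dim_posSL.
have [sg tC _ _ _] := aC; have ug := SL3_unit sg.
exists g => // x [xC x1 _]; exists (fr g x); last exact: frK.
split; last exact: tC.
by rewrite /SL3 /= det_fr.
Qed.

End PositiveParts.

(** * From abelian groups to algebras *)

Section Newton.
Variable R : realType.
Local Notation M3 := 'M[R]_3.
Implicit Types (g x y X : M3) (C V : {vspace M3}).

(** To first order a product of numbers close to 1 is 1 plus the sum of the
    deviations. *)
Lemma sum_small_prod1 (a b c e : R) : `|a| <= e -> `|b| <= e -> `|c| <= e ->
  e <= 1 -> (1 + a) * (1 + b) * (1 + c) = 1 -> `|a + b + c| <= 4 * e ^+ 2.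
Proof.
move=> ae be ce e1 abc.
have e0 : 0 <= e by exact: le_trans ae.
have -> : a + b + c = - (a * b + b * c + a * c + a * b * c).
  apply/eqP; rewrite -subr_eq0; apply/eqP.
  transitivity ((1 + a) * (1 + b) * (1 + c) - 1); first by ring.
  by rewrite abc subrr.
have mul2 (p q : R) : `|p| <= e -> `|q| <= e -> `|p * q| <= e ^+ 2.
  by move=> pe qe; rewrite normrM expr2 ler_pM.
rewrite normrN (_ : 4 * e ^+ 2 = e ^+ 2 + e ^+ 2 + e ^+ 2 + e ^+ 2); last by ring.
rewrite (le_trans (ler_normD _ _))// lerD//.
  rewrite (le_trans (ler_normD _ _))// lerD ?mul2//.
  by rewrite (le_trans (ler_normD _ _))// lerD ?mul2.
rewrite normrM -[leRHS]mulr1 ler_pM ?mul2//.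
exact: le_trans ce e1.
Qed.

(** One step of Newton's method for the equation exp Y = z.  Write z = 1 + y and
    y = X + a with X in V and a scalar.  The condition det z = 1 makes a of
    second order in y, so exp (- X) z = (1 - X + O(y ^ 2)) (1 + y) differs from 1
    by terms of second order in y. *)
Lemma newton_step g C V : triAlg g C -> (C = V + <[1%:M]>)%VS ->
  (forall X, X \in V -> \tr X = 0) ->
  exists2 r : R, 0 < r & forall z, z \in C -> \det z = 1 -> `|z - 1| <= r ->
    exists2 X, X \in V & `|expmx X *m z - 1| <= `|z - 1| / 2.
Proof.
move=> aC CE trV; have [sg tC C1 _ _] := aC; have ug := SL3_unit sg.
pose N1 := `|1 : M3|; pose M := 9 * `|invmx g| * `|g|; pose K := expK R.
have K0 : 0 <= K by rewrite mulr_ge0// expR_ge0.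
have M0 : 0 <= M by rewrite !mulr_ge0.
have N0 : 0 <= N1 by exact: normr_ge0.
(* L collects the constants of the second order terms below, so that the new
   error is at most L d ^ 2; the radius 1 / (2 L) turns this into d / 2. *)
pose L := 2 * M ^+ 2 * N1 + 6 + 12 * K * (N1 + 1) + M.
have MN : 0 <= 2 * M ^+ 2 * N1 by rewrite !mulr_ge0// exprn_ge0.
have KN : 0 <= 12 * K * (N1 + 1) by rewrite !mulr_ge0// addr_ge0.
have L6 : 6 <= L by rewrite /L; lra.
have L0 : 0 < L by lra.
exists (2 * L)^-1; first by rewrite invr_gt0 mulr_gt0.
move=> z zC z1; set y := z - 1; set d := `|y| => dr.
have d0 : 0 <= d by exact: normr_ge0.
have dL : d * L <= 1 / 2.
  move: dr; rewrite -(ler_pM2r L0) invfM -mulrA mulVf ?lt0r_neq0// mulr1.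
  by rewrite div1r.
have yC : y \in C by apply: memvB.
have d6 : 6 * d <= 1 / 2 by apply: le_trans dL; rewrite mulrC ler_wpM2l.
have /memv_addP[X XV [_ /vlineP[a ->] yE]] : y \in (V + <[1%:M]>)%VS by rewrite -CE.
have tr_y : \tr y = 3 * a.
  by rewrite yE mxtraceD trV// add0r mxtraceZ mxtrace1 mulrC.
have Md : M * d <= 1.
  have : d * M <= d * L by rewrite ler_wpM2l// /L; lra.
  by lra.
have chi_small i : `|chi g i y| <= M * d.
  rewrite (le_trans (norm_coord _ _ _))// /fr.
  have h1 : `|invmx g *m y *m g| <= 3 * `|invmx g *m y| * `|g| := normM3 _ _.
  have h2 : `|invmx g *m y| <= 3 * `|invmx g| * `|y| := normM3 _ _.
  rewrite (le_trans h1)// /M -/d.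
  rewrite (_ : 9 * _ * _ * _ = 3 * (3 * `|invmx g| * d) * `|g|); last by ring.
  by rewrite ler_wpM2r// ler_wpM2l.
have a_small : `|a| <= 2 * M ^+ 2 * d ^+ 2.
  have : `|3 * a| <= 4 * (M * d) ^+ 2.
    rewrite -tr_y (trace_tri y ug) !big_ord_recl big_ord0 addr0 addrA.
    apply: sum_small_prod1 => //.
    have zE i : chi g i z = 1 + chi g i y.
      by rewrite -{1}(chi1 i ug) -chiD addrC subrK.
    move: z1; rewrite (det_tri ug (tC _ zC)) !big_ord_recl big_ord0 mulr1 mulrA.
    by rewrite !zE.
  rewrite normrM ger0_norm// exprMn.
  have : 0 <= M ^+ 2 * d ^+ 2 by rewrite mulr_ge0 ?exprn_ge0.
  by move: (M ^+ 2) (d ^+ 2) => p q; nra.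
have aN : `|a| * N1 <= d * (d * (2 * M ^+ 2 * N1)).
  rewrite (_ : d * _ = 2 * M ^+ 2 * d ^+ 2 * N1); last by ring.
  by rewrite ler_wpM2r.
have aNd : `|a| * N1 <= d.
  apply: (le_trans aN); rewrite ler_piMr//.
  have : d * (2 * M ^+ 2 * N1) <= d * L by rewrite ler_wpM2l// /L; lra.
  by lra.
have Xd : `|X| <= 2 * d.
  have -> : X = y - a *: 1 by rewrite yE addrK.
  by rewrite (le_trans (ler_normB _ _))// normrZ -/d -/N1; lra.
have X1 : `|- X| <= 1 by rewrite normrN; lra.
exists (- X); first by rewrite memvN.
have := expmx_approx X1; rewrite opprK normrN.
set E := expmx (- X) - 1 + X => Ed.
have {}Ed : `|E| <= K * (4 * d ^+ 2).
  apply: (le_trans Ed); apply: ler_wpM2l => //.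
  rewrite (_ : 4 * _ = (2 * d) ^+ 2); last by ring.
  by rewrite !expr2 ler_pM.
have zd : `|z| <= N1 + 1.
  have -> : z = 1 + y by rewrite addrC subrK.
  by rewrite (le_trans (ler_normD _ _))// lerD2l -/d; lra.
have -> : expmx (- X) *m z - 1 = a *: 1 - X * y + E * z.
  have -> : expmx (- X) = (1 - X) + E.
    have -> : E = expmx (- X) - (1 - X) by rewrite opprB addrA addrAC.
    by rewrite addrC subrK.
  have id1 : (1 - X) * z - 1 = a *: 1 - X * y.
    have -> : z = 1 + y by rewrite addrC subrK.
    rewrite mulrBl mul1r mulrDr mulr1 [1 + y]addrC addrAC addrK.
    by rewrite {1}yE opprD addrA [X + _]addrC addrK.
  by rewrite -[LHS]/((1 - X + E) * z - 1) mulrDl addrAC id1.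
rewrite (le_trans (ler_normD _ _))//.
have h1 : `|a *: 1 - X * y| <= `|a| * N1 + 6 * d ^+ 2.
  rewrite (le_trans (ler_normB _ _))// normrZ lerD2l.
  rewrite (le_trans (normM3 _ _))// -/d.
  rewrite (_ : 6 * _ = 3 * (2 * d) * d); last by ring.
  by rewrite ler_wpM2r// ler_wpM2l.
have h2 : `|E * z| <= d ^+ 2 * (12 * K * (N1 + 1)).
  rewrite (le_trans (normM3 _ _))//.
  rewrite (_ : d ^+ 2 * _ = 3 * (K * (4 * d ^+ 2)) * (N1 + 1)); last by ring.
  by rewrite ler_pM ?mulr_ge0// ler_wpM2l.
have h3 : d * (d * L) <= d * (1 / 2) by rewrite ler_wpM2l.
rewrite (le_trans (lerD h1 h2))//.
apply: le_trans (_ : d * (d * L) <= _); last by rewrite -/y -/d; lra.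
have : 0 <= d * (d * M) by rewrite !mulr_ge0.
by move: aN; rewrite /L !mulrDr expr2; lra.
Qed.

End Newton.

Section AbelianGroups.
Variable R : realType.
Local Notation M3 := 'M[R]_3.
Implicit Types (g x y X : M3) (C V : {vspace M3}).

(** Iterating newton_step produces h_n in H with h_n z tending to 1, so z is the
    inverse of the limit of h_n, which belongs to H. *)
Lemma subgroup_near1 g C V (H : closedSubgroup R) : triAlg g C ->
  (C = V + <[1%:M]>)%VS -> (forall X, X \in V -> \tr X = 0) ->
  (H : set M3) `<=` posSL g C -> (forall X, X \in V -> (H : set M3) (expmx X)) ->
  exists2 r : R, 0 < r &
    forall z, posSL g C z -> `|z - 1| <= r -> (H : set M3) z.
Proof.
move=> aC CE trV HP HV; have [r r0 step] := newton_step aC CE trV.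
have [_ clH H1 HM Hinv] := csubP H.
exists r => // z Pz zr; have uz : z \in unitmx by case: Pz => _ /SL3_unit.
have iter n : exists2 h, (H : set M3) h & `|h *m z - 1| <= r / 2 ^+ n.
  elim: n => [|n [h Hh hn]].
    by exists 1%:M => //; rewrite mul1mx expr0 divr1.
  have [hzC hz1 _] := posSLM aC (HP _ Hh) Pz.
  have hr : `|h *m z - 1| <= r.
    apply: (le_trans hn); rewrite ler_pdivrMr ?exprn_gt0//.
    by rewrite ler_peMr ?(ltW r0)// exprn_ege1// ler1n.
  have [X XV hX] := step _ hzC hz1 hr.
  exists (expmx X *m h); first by apply: HM => //; exact: HV.
  rewrite -mulmxA (le_trans hX)// exprSr invfM mulrA ler_pdivrMr//.
  by rewrite mulfVK.
have /choice[h hP] : forall n, exists h, (H : set M3) h /\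
    `|h *m z - 1| <= r / 2 ^+ n.
  by move=> n; have [h ? ?] := iter n; exists h.
rewrite -[z]invmxK; apply: Hinv.
have hz1 : (fun n => h n *m z) @ \oo --> (1%:M : M3).
  apply/cvgrPdist_le => e e0.
  have : (fun n => r * 2^-1 ^+ n) @ \oo --> r * 0.
    apply: cvgM; first exact: cvg_cst.
    by apply: cvg_expr; rewrite ger0_norm ?invf_lt1// ?ltr1n.
  rewrite mulr0 => /cvgrPdist_le/(_ _ e0); apply: filterS => n.
  rewrite sub0r normrN ger0_norm ?mulr_ge0 ?exprn_ge0 ?(ltW r0)// => rn.
  rewrite distrC; have [_ hn] := hP n; apply: (le_trans hn).
  by rewrite -exprVn.
have : h @ \oo --> invmx z.
  rewrite -[X in _ --> X]mul1mx.
  rewrite (_ : h = fun n => h n *m z *m invmx z).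
    by apply: cvg_mulmx hz1 _; exact: cvg_cst.
  by apply/funext => n; rewrite mulmxK.
apply: (@closed_cvg _ _ _ _ h (csub_set H)) => //.
by apply: nearW => n; have [] := hP n.
Qed.

(** H is closed, and by subgroup_near1 and translation it is open in the connected
    group posSL g C. *)
Lemma subgroup_full g C V (H : closedSubgroup R) : triAlg g C ->
  (C = V + <[1%:M]>)%VS -> (forall X, X \in V -> \tr X = 0) ->
  (H : set M3) `<=` posSL g C -> (forall X, X \in V -> (H : set M3) (expmx X)) ->
  (H : set M3) = posSL g C.
Proof.
move=> aC CE trV HP HV.
have [r r0 near1] := subgroup_near1 aC CE trV HP HV.
have [_ clH H1 HM Hinv] := csubP H.
apply: (connected_posSL aC); first by exists 1%:M.
(* H is the trace on posSL g C of the interior of H together with the complement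
   of posSL g C. *)
- exists (csub_set H `|` ~` posSL g C)^°; first exact: open_interior.
  apply/seteqP; split=> [h Hh|h [Ph /interior_subset[//|]]]; last by [].
  split; first exact: HP.
  have uh : h \in unitmx by have [_ /SL3_unit] := HP h Hh.
  have : (fun x => invmx h *m x) @ (nbhs h) --> (1 : M3).
    rewrite -[X in _ --> X]/(1%:M : M3) -(mulVmx uh).
    by apply: cvg_mulmx; [exact: cvg_cst|exact: cvg_id].
  move=> /cvgrPdist_le/(_ _ r0); apply: filterS => x xr.
  have [Px|] := pselect (posSL g C x); last by right.
  left; rewrite -(mulKVmx uh x); apply: HM => //; apply: near1.
    by apply: posSLM => //; apply: posSLV => //; exact: HP.
  by rewrite distrC.
- by exists (csub_set H) => //; apply/esym/setIidPr.
Qed.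

(** The algebra is C = V + scalars, where V is the Lie algebra of H.  H commutes
    with V because it commutes with the one-parameter groups that generate V, so
    H lies in C by triAlgP.  An eigenvalue of an element of H cannot vanish, so on
    the connected set H it keeps the sign that it has at the identity. *)
Lemma calA_ex (H : closedSubgroup R) : calA H ->
  exists g, exists2 C : {vspace M3}, triAlg g C & (H : set M3) = posSL g C.
Proof.
case=> [conH abH [V VE dV] [g sg HB]].
have ug := SL3_unit sg; have [HSL clH H1 HM Hinv] := csubP H.
have VP X : X \in V <-> lie_algebra H X.
  by have -> : lie_algebra H X = [set X | X \in V] X by rewrite VE.
have Vexp X : X \in V -> (H : set M3) (expmx X).
  by move=> /VP/(_ 1); rewrite scale1r.
have tH x : (H : set M3) x -> tri g x.
  by move=> /HB[b [_ ub] <-]; rewrite /tri frKV.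
have tV X : X \in V -> tri g X.
  move=> /VP LX.
  have [|u tu uX] := @lie_algebra_cvg _ _ [set x | tri g x] X LX.
    move=> h a Hh /=; apply/triZ/triD; first exact: tH.
    by rewrite -scaleN1r; apply/triZ/tri1.
  by apply: (@tri_cvg _ _ \oo _ (fun=> g) u) => //;
    try exact: cvg_cst; exact: nearW.
have cVH X x : X \in V -> (H : set M3) x -> X *m x = x *m X.
  move=> /VP LX Hx.
  have [|u cu uX] := @lie_algebra_cvg _ _ [set y | y *m x = x *m y] X LX.
    move=> h a Hh /=.
    by rewrite -scalemxAl -scalemxAr mulmxBl mulmxBr (abH h x)// mul1mx mulmx1.
  by apply: (@commute_cvg _ _ \oo _ u (fun=> x)) => //;
    try exact: cvg_cst; exact: nearW.
have cV : commuting V.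
  move=> X Y XV YV; have LX := (VP X).1 XV.
  have [|u cu uX] := @lie_algebra_cvg _ _ [set y | y *m Y = Y *m y] X LX.
    move=> h a Hh /=.
    by rewrite -scalemxAl -scalemxAr mulmxBl mulmxBr -(cVH Y h)// mul1mx mulmx1.
  by apply: (@commute_cvg _ _ \oo _ u (fun=> Y)) => //;
    try exact: cvg_cst; exact: nearW.
have trV X : X \in V -> \tr X = 0.
  move=> XV; have := HSL _ (Vexp X XV); rewrite /SL3 /= (det_expmx ug (tV _ XV)).
  by rewrite -expR0 => /expR_inj.
pose C := (V + <[1%:M]>)%VS.
have aC : triAlg g C.
  split=> //.
  - move=> _ /memv_addP[X XV [_ /vlineP[a ->] ->]].
    by apply: triD; [exact: tV | apply/triZ/tri1].
  - by apply: (subvP (addvSr V _)); exact: memv_line.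
  - by apply: commuting_addl => // X XV; rewrite mul1mx mulmx1.
  rewrite dimv_disjoint_sum ?dV ?dim_vline ?oner_eq0//.
  apply/eqP; rewrite -subv0; apply/subvP => x; rewrite memv_cap memv0.
  move=> /andP[/trV x0 /vlineP[a xE]]; move: x0; rewrite xE mxtraceZ mxtrace1.
  by move=> /eqP; rewrite mulf_eq0 pnatr_eq0 orbF => /eqP ->; rewrite scale0r.
exists g, C => //; apply: (subgroup_full aC erefl trV) => // x Hx.
have Hdet y : (H : set M3) y -> \prod_i chi g i y = 1.
  by move=> Hy; rewrite -(det_tri ug (tH y Hy)); exact: HSL.
split; [|exact: HSL|move=> i].
  apply/(triAlgP _ aC); split; first exact: tH.
  move=> _ /memv_addP[X XV [_ /vlineP[a ->] ->]].
  by rewrite mulmxDl mulmxDr (cVH X x)// -scalemxAl -scalemxAr mul1mx mulmx1.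
rewrite ltNge; apply/negP => xle0.
have : connected (chi g i @` (csub_set H)).
  apply: connected_continuous_connected => //; apply: continuous_subspaceT => y.
  by apply: (@cvg_chi _ _ (nbhs y) _ (fun=> g) id); try exact: cvg_cst; exact: cvg_id.
move=> /connected_intervalP/(_ (chi g i x) 1).
move=> /(_ _ _ 0) [|||y Hy y0].
- by exists x.
- by exists 1%:M => //; rewrite chi1.
- by rewrite xle0 ler01.
have : \prod_i chi g i y != 0 by rewrite Hdet// oner_eq0.
by move=> /prodf_neq0/(_ i isT); rewrite y0 eqxx.
Qed.

End AbelianGroups.

(** * Orthonormal bases *)

Section GramSchmidt.
Variable R : rcfType.

(** Rows are orthonormalized from the last one upwards, which makes the change of
    basis L upper triangular. *)
Lemma gram_schmidt m n (A : 'M[R]_(m, n)) : row_free A ->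
  exists2 L : 'M[R]_m, upper L & (L *m A) *m (L *m A)^T = 1%:M.
Proof.
elim: m A => [|m IH] A fA.
  by exists 0; [move=> i j ij; rewrite mxE | apply/matrixP => -[]].
rewrite -[m.+1]/(1 + m)%N in A fA *.
set a := usubmx A; set A' := dsubmx A.
have AE : A = col_mx a A' by rewrite vsubmxK.
have fA0 (v : 'rV_(1 + m)) : v *m A = 0 -> v = 0.
  by move=> vA; apply: (row_free_inj fA); rewrite vA mul0mx.
have fA' : row_free A'.
  apply: inj_row_free => v vA'.
  have : row_mx 0 v = 0 :> 'rV_(1 + m).
    by apply: fA0; rewrite AE mul_row_col mul0mx add0r.
  by rewrite -row_mx0 => /eq_row_mx[].
have [L uL BB] := IH A' fA'; set B := L *m A' in BB.
pose a' := a - (a *m B^T) *m B.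
have a'B : a' *m B^T = 0 by rewrite mulmxBl -[X in _ - X]mulmxA BB mulmx1 subrr.
have a'0 : a' != 0.
  apply/eqP => a'0.
  have : row_mx 1%:M (- ((a *m B^T) *m L)) = 0 :> 'rV_(1 + m).
    by apply: fA0; rewrite AE mul_row_col mul1mx mulNmx -!mulmxA -[L *m A']/B mulmxA.
  rewrite -row_mx0 => /eq_row_mx[/matrixP/(_ 0 0)/eqP].
  by rewrite !mxE eqxx oner_eq0.
pose s := (a' *m a'^T) 0 0.
have s0 : 0 < s.
  have sE : s = \sum_i a' 0 i ^+ 2.
    by rewrite /s mxE; apply: eq_bigr => i _; rewrite [X in _ * X]mxE -expr2.
  rewrite lt_neqAle sE sumr_ge0 ?andbT => [|i _]; last exact: sqr_ge0.
  apply: contra a'0; rewrite eq_sym psumr_eq0 => [/allP z|i _]; last exact: sqr_ge0.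
  apply/eqP/rowP => i; rewrite [RHS]mxE; apply/eqP.
  by have := z i (mem_index_enum i); rewrite implyTb sqrf_eq0.
pose c := (Num.sqrt s)^-1.
pose L1 : 'M[R]_(1 + m) := block_mx c%:M (- (c *: (a *m B^T *m L))) 0 L.
exists L1.
  move=> i j; rewrite /L1.
  case: (split_ordP i) => i' ->; case: (split_ordP j) => j' ->; rewrite ?ord1 //=.
    by rewrite block_mxEdl mxE.
  by rewrite ltn_add2l => ij; rewrite block_mxEdr uL.
have -> : L1 *m A = col_mx (c *: a') B.
  rewrite AE mul_block_col mul0mx add0r -/B; congr (col_mx _ _).
  by rewrite mul_scalar_mx mulNmx -scalemxAl -[_ *m A']mulmxA -/B -scalerBr.
rewrite tr_col_mx mul_col_row BB linearZ /= -!scalemxAl a'B scaler0.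
rewrite -!scalemxAr -[B *m a'^T]trmxK trmx_mul trmxK a'B trmx0 scaler0.
apply: (etrans _ (esym (@scalar_mx_block _ 1 m 1))); congr block_mx.
apply/matrixP => i j; rewrite !ord1 [LHS]mxE [X in _ * X]mxE -/s mxE eqxx.
rewrite mulrA -invfM -expr2 sqr_sqrtr ?ltW// mulVf ?gt_eqF//.
Qed.

End GramSchmidt.

Section OrthonormalBases.
Variable R : realType.
Local Notation M3 := 'M[R]_3.
Implicit Types (g k u x y : M3) (C : {vspace M3}) (b : 'I_3 -> M3).

(** Orthonormality for the inner product tr (x y^T), the sum of the products of
    the entries. *)
Definition tr_orthonormal b := forall i j, \tr (b i *m (b j)^T) = (i == j)%:R.

Definition comb b (v : 'rV[R]_3) : M3 := \sum_i v 0 i *: b i.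

Lemma comb_is_linear b : linear (comb b).
Proof.
move=> a v w; rewrite /comb scaler_sumr -big_split /=; apply: eq_bigr => i _.
by rewrite !mxE scalerDl scalerA.
Qed.

HB.instance Definition _ b := GRing.isLinear.Build R _ _ _ (comb b)
  (@comb_is_linear b).

Definition spanb b : {vspace M3} := (linfun (comb b) @: fullv)%VS.

Lemma spanbP b x : reflect (exists v, x = comb b v) (x \in spanb b).
Proof.
apply: (iffP memv_imgP) => [[v _ ->]|[v ->]]; exists v; rewrite ?memvf ?lfunE//.
Qed.

Lemma comb_coord b v i : tr_orthonormal b -> \tr (comb b v *m (b i)^T) = v 0 i.
Proof.
move=> ob; rewrite /comb mulmx_suml raddf_sum /= (bigD1 i)//= big1 => [|j ji].
  by rewrite addr0 -scalemxAl mxtraceZ ob eqxx mulr1.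
by rewrite -scalemxAl mxtraceZ ob (negbTE ji) mulr0.
Qed.

(** Coordinates are inner products, so they depend continuously on x and b. *)
Lemma spanb_expand b x : tr_orthonormal b -> x \in spanb b ->
  x = comb b (\row_i \tr (x *m (b i)^T)).
Proof.
move=> ob /spanbP[v ->]; congr comb; apply/rowP => i.
by rewrite mxE comb_coord.
Qed.

Lemma dim_spanb b : tr_orthonormal b -> \dim (spanb b) = 3%N.
Proof.
move=> ob; rewrite limg_dim_eq ?dimvf//.
apply/eqP; rewrite -subv0; apply/subvP => v; rewrite memv_cap memv_ker memv0 lfunE.
move=> /andP[_ /eqP v0]; apply/eqP/rowP => i; rewrite mxE -(comb_coord v i ob).
by rewrite [comb b v]v0 mul0mx mxtrace0.
Qed.

Lemma orthonormal_bound b i p q : tr_orthonormal b -> `|b i p q| <= 1.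
Proof.
move=> ob; have := ob i i; rewrite eqxx /mxtrace (bigD1 p)//= mxE (bigD1 q)//=.
rewrite [(b i)^T q p]mxE -expr2 => E.
have : b i p q ^+ 2 <= 1.
  rewrite -[leRHS]E -addrA lerDl addr_ge0// sumr_ge0// => j _.
    by rewrite mxE -expr2 sqr_ge0.
  rewrite mxE sumr_ge0// => l _.
  by rewrite [(b i)^T l j]mxE -expr2 sqr_ge0.
by rewrite -[X in _ <= X](expr1n _ 2) -real_normK ?num_real// ler_pXn2r ?nnegrE.
Qed.

Lemma mxvec_inner x y : (mxvec x *m (mxvec y)^T) 0 0 = \tr (x *m y^T).
Proof.
transitivity (\sum_(p : 'I_3 * 'I_3) x p.1 p.2 * y p.1 p.2).
  rewrite mxE (reindex _ (curry_mxvec_bij _ _)) /=.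
  by apply: eq_bigr => -[i j] _; rewrite [(mxvec y)^T _ _]mxE /= !mxvecE.
rewrite -(pair_bigA _ (fun i j => x i j * y i j)) /=.
by apply: eq_bigr => i _; rewrite mxE; apply: eq_bigr => j _; rewrite [y^T _ _]mxE.
Qed.

(** The Gram-Schmidt process applied to the coordinate rows of a basis of C. *)
Lemma orthonormal_basis C : \dim C = 3%N ->
  exists2 b, tr_orthonormal b & spanb b = C.
Proof.
move=> dC; pose A := \matrix_(i < 3) mxvec (vbasis C)`_i.
have fA : row_free A.
  apply: inj_row_free => v vA; apply/rowP => i; rewrite mxE.
  have /freeP indep := basis_free (vbasisP C).
  have := indep (fun i => v 0 (cast_ord dC i)); move=> /(_ _ (cast_ord (esym dC) i)).
  rewrite cast_ordKV; apply.
  apply: (can_inj mxvecK); rewrite linear0 -vA.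
  rewrite (mulmx_sum_row v A) linear_sum (reindex (cast_ord dC)) /=.
    by apply: eq_bigr => j _; rewrite linearZ /= rowK.
  by exists (cast_ord (esym dC)) => j _; rewrite ?cast_ordK ?cast_ordKV.
have [L uL LA] := gram_schmidt fA.
pose b i := vec_mx (row i (L *m A)) : M3.
have ob : tr_orthonormal b.
  move=> i j; rewrite -mxvec_inner !vec_mxK.
  have /matrixP/(_ i j) := LA; rewrite !mxE => <-.
  by apply: eq_bigr => l _; rewrite !mxE.
exists b => //; apply/eqP.
rewrite -(geq_leqif (dimv_leqif_eq _)) ?dim_spanb ?dC//.
apply/subvP => _ /spanbP[v ->]; apply: memv_suml => i _; apply: memvZ.
rewrite /b row_mul mulmx_sum_row linear_sum; apply: memv_suml => j _.
rewrite linearZ /= rowK mxvecK; apply: memvZ; apply: vbasis_mem.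
by rewrite mem_nth// size_tuple dC.
Qed.

End OrthonormalBases.

(** * Cartan subgroups as positive unimodular elements *)

Section DiagonalAlgebras.
Variable R : realType.
Local Notation M3 := 'M[R]_3.
Implicit Types (g k u x y : M3) (C : {vspace M3}).

Definition conj_diag u (d : 'rV[R]_3) : M3 := u *m diag_mx d *m invmx u.

Lemma conj_diag_is_linear u : linear (conj_diag u).
Proof.
by move=> a v w; rewrite /conj_diag linearP /= mulmxDr mulmxDl -scalemxAr -scalemxAl.
Qed.

HB.instance Definition _ u := GRing.isLinear.Build R _ _ _ (conj_diag u)
  (@conj_diag_is_linear u).

(** The algebra of the matrices that are diagonal in the basis formed by the
    columns of u. *)
Definition diagAlg u : {vspace M3} := (linfun (conj_diag u) @: fullv)%VS.

Lemma diagAlgP u x : reflect (exists d, x = conj_diag u d) (x \in diagAlg u).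
Proof.
apply: (iffP memv_imgP) => [[v _ ->]|[v ->]]; exists v; rewrite ?memvf ?lfunE//.
Qed.

Lemma fr_conj_diag u d : u \in unitmx -> fr u (conj_diag u d) = diag_mx d.
Proof. by move=> uu; rewrite frKV. Qed.

(** In the frame g the matrix is b d b^-1 with b = g^-1 u upper triangular, so it
    is triangular with the same diagonal as d. *)
Lemma tri_chi_conj_diag g u d i : SL3 g -> SL3 u -> upper (invmx g *m u) ->
  tri g (conj_diag u d) /\ chi g i (conj_diag u d) = d 0 i.
Proof.
move=> sg su ub; have ug := SL3_unit sg; have uu := SL3_unit su.
set b := invmx g *m u in ub.
have bu : b \in unitmx by rewrite unitmx_mul unitmx_inv ug.
have frE : fr g (conj_diag u d) = b *m diag_mx d *m invmx b.
  have -> : invmx b = invmx u *m g.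
    apply: (can_inj (mulKmx bu)); rewrite mulmxV// /b.
    by rewrite -mulmxA mulKVmx// mulVmx.
  by rewrite /fr /conj_diag /b !mulmxA.
have ud : upper (diag_mx d).
  by move=> p q pq; rewrite mxE -val_eqE gtn_eqF// mulr0n.
have ubi := upper_invmx bu ub.
split; first by rewrite /tri frE; exact: upperM (upperM ub ud) ubi.
rewrite /chi frE upper_diagM//; last exact: upperM.
rewrite upper_diagM// mulrAC -upper_diagM// mulmxV// [1%:M _ _]mxE.
by rewrite mxE eqxx mulr1n mul1r.
Qed.

Lemma triAlg_diag g u : SL3 g -> SL3 u -> upper (invmx g *m u) ->
  triAlg g (diagAlg u).
Proof.
move=> sg su ub; have uu := SL3_unit su; split=> //.
- by move=> _ /diagAlgP[d ->]; have [] := tri_chi_conj_diag d 0 sg su ub.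
- apply/diagAlgP; exists (const_mx 1).
  by rewrite /conj_diag diag_const_mx mulmx1 mulmxV.
- move=> _ _ /diagAlgP[d ->] /diagAlgP[e ->].
  rewrite /conj_diag !mulmxA !mulmxKV//; congr (_ *m _).
  by rewrite -!mulmxA; congr (_ *m _); rewrite !mulmx_diag; congr diag_mx;
    apply/rowP => i; rewrite !mxE mulrC.
rewrite limg_dim_eq ?dimvf//.
apply/eqP; rewrite -subv0; apply/subvP => v; rewrite memv_cap memv_ker memv0 lfunE.
move=> /andP[_ /eqP /(congr1 (fr u))]; rewrite fr_conj_diag// linear0 => v0.
apply/eqP/rowP => i; have /matrixP/(_ i i) := v0.
by rewrite !mxE eqxx mulr1n.
Qed.

Lemma conj_diag_pos g u : SL3 g -> SL3 u -> upper (invmx g *m u) ->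
  conj_by u (@diag_pos R) = posSL g (diagAlg u).
Proof.
move=> sg su ub; have uu := SL3_unit su.
have dE d : \det (conj_diag u d) = \det (diag_mx d).
  by rewrite -(det_fr _ uu) fr_conj_diag.
apply/seteqP; split=> [_ [a [/is_diag_mxP ad a0 a1] <-]|_ [/diagAlgP[d ->] d1 d0]].
  have aE : a = diag_mx (\row_i a i i).
    apply/matrixP => i j; rewrite !mxE.
    by have [->|/ad ->] := eqVneq i j; rewrite ?mulr1n ?mulr0n.
  rewrite aE -/(conj_diag u _).
  split; first by apply/diagAlgP; eexists.
    by rewrite dE -aE.
  by move=> i; have [_ ->] := tri_chi_conj_diag (\row_i a i i) i sg su ub; rewrite mxE.
exists (diag_mx d) => //; split.
- exact: diag_mx_is_diag.
- move=> i; rewrite mxE eqxx mulr1n; have := d0 i.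
  by have [_ ->] := tri_chi_conj_diag d i sg su ub.
- by rewrite -dE.
Qed.

(** The factorization u = k b with k in SO(3) and b upper triangular.  It comes
    from orthonormalizing the rows of u^-1: if B = L u^-1 is orthogonal, then
    B u = L. *)
Lemma triangular_frame u : SL3 u ->
  exists k, [/\ SL3 k, k^T *m k = 1%:M, invmx k = k^T & upper (invmx k *m u)].
Proof.
move=> su; have uu := SL3_unit su.
have fu : row_free (invmx u) by rewrite row_free_unit unitmx_inv.
have [L uL LL] := gram_schmidt fu.
have [B [BB uB B1]] : exists B : M3,
    [/\ B *m B^T = 1%:M, upper (B *m u) & \det B = 1].
  set B := L *m invmx u in LL.
  have uB : upper (B *m u) by rewrite mulmxKV.
  have : \det B ^+ 2 = 1 by rewrite expr2 -{2}(det_tr B) -det_mulmx LL det1.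
  move=> /eqP; rewrite sqrf_eq1 => /orP[/eqP d1|/eqP d1]; first by exists B.
(* The size is odd, so changing the sign of B changes that of its determinant. *)
  exists (- B); split.
  - by rewrite linearN /= mulNmx mulmxN opprK.
  - by rewrite mulNmx => i j ij; rewrite mxE uB// oppr0.
  - by rewrite -scaleN1r detZ d1 -signr_odd expr1 mulrNN mulr1.
have iB : invmx B^T = B.
  have uBT : B^T \in unitmx by rewrite unitmx_tr unitmxE B1 unitr1.
  by apply: (can_inj (mulKmx uBT)); rewrite mulmxV// mulmx1C.
exists B^T; split; rewrite ?trmxK ?iB//; first by rewrite /SL3 /= det_tr.
Qed.

End DiagonalAlgebras.

(** * Limits of Cartan subgroups *)

Section ChabautyFilters.
Variable R : realType.
Local Notation M3 := 'M[R]_3.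
Variable F : set_system (closedSubgroup R).
Context {FF : ProperFilter F}.
Variable H : closedSubgroup R.
Hypothesis FH : F --> H.

(** f K is a point of K whose distance to h is at most twice the distance from h to
    any point of K.  Since K eventually meets each ball around h, these points
    tend to h. *)
Lemma csub_lim_in h : (H : set M3) h ->
  exists2 f : closedSubgroup R -> M3,
    (forall K : closedSubgroup R, (K : set M3) (f K)) & f @ F --> h.
Proof.
move=> Hh.
have near_pt (K : closedSubgroup R) : exists y, (K : set M3) y /\
    forall z, (K : set M3) z -> `|h - y| <= 2 * `|h - z|.
  have [Kh|nKh] := pselect ((K : set M3) h).
    by exists h; split=> // z _; rewrite subrr normr0 mulr_ge0.
  have [_ clK K1 _ _] := csubP K.
  have /nbhs_ballP[e e0 eK] : nbhs h (~` csub_set K).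
    by apply: open_nbhs_nbhs; split=> //; exact: closed_openC.
  pose D := [set `|h - x| | x in csub_set K].
  have infD : has_inf D.
    by split; [exists `|h - 1%:M|, 1%:M | exists 0 => _ [x _ <-]].
  have eD : e <= inf D.
    apply: lb_le_inf; first by case: infD.
    move=> _ [x Kx <-]; rewrite leNgt; apply/negP => hx.
    by apply: (eK x) => //; rewrite -ball_normE.
  have D0 : 0 < inf D by exact: lt_le_trans eD.
  have [_ [x Kx <-] xD] := inf_adherent D0 infD.
  exists x; split=> // z Kz; rewrite (le_trans (ltW xD))// -mulr2n -[leLHS]mulr_natl.
  rewrite ler_wpM2l//; apply: ge_inf; first by case: infD.
  by exists z.
have /choice[f fP] := near_pt; exists f => [K|]; first by have [] := fP K.
apply/cvgrPdist_lt => e e0.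
have e20 : 0 < e / 2 by rewrite divr_gt0.
have : F (csub_hit (ball h (e / 2))).
  apply: FH; apply: open_nbhs_nbhs; split.
    exact/open_csub_hit/ball_open.
  by exists h; split=> //; exact: ballxx.
apply: filterS => K [z [Kz]]; rewrite -ball_normE /= => hz.
have [_ /(_ z Kz) le2] := fP K.
by apply: (le_lt_trans le2); rewrite mulrC -ltr_pdivlMr.
Qed.

(** If h were outside H, some compact box around h would miss H, hence would
    eventually miss K. *)
Lemma csub_lim_out (f : closedSubgroup R -> M3) h :
  (\forall K \near F, csub_set K (f K)) -> f @ F --> h -> (H : set M3) h.
Proof.
move=> fK fh; apply: contrapT => nHh.
have [_ clH _ _ _] := csubP H.
have /nbhs_ballP[e e0 eH] : nbhs h (~` csub_set H).
  by apply: open_nbhs_nbhs; split=> //; exact: closed_openC.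
have e20 : 0 < e / 2 by rewrite divr_gt0.
pose B := [set x : M3 | forall i j, x i j \in `[h i j - e / 2, h i j + e / 2]].
have FB : F (csub_miss B).
  apply: FH; apply: open_nbhs_nbhs; split; first exact/open_csub_miss/compact_box.
  rewrite /csub_miss /= -subset0 => x [Hx Bx]; apply: (eH x) => //.
  split=> // i j; rewrite -ball_normE /=.
  have := Bx i j; rewrite in_itv /= -ler_distlC => /le_lt_trans; apply.
  by rewrite ltr_pdivrMr// ltr_pMr// ltr1n.
have Ff : \forall K \near F, `|h - f K| < e / 2 by move/cvgrPdist_lt : fh; apply.
have [K [[KB fKK] hK]] := @filter_ex _ _ FF _ (filterI (filterI FB fK) Ff).
move: KB; rewrite /csub_miss /= -subset0; apply; split; first exact: fKK.
move=> i j; rewrite in_itv /= -ler_distlC (le_trans _ (ltW hK))//.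
by have := norm_coord (h - f K) i j; rewrite !mxE.
Qed.

End ChabautyFilters.

Section LimitsOfCartans.
Variable R : realType.
Local Notation M3 := 'M[R]_3.
Implicit Types (g k u x y : M3) (C : {vspace M3}) (b : 'I_3 -> M3).

Lemma ultra_fmap T U (F : set_system T) (f : T -> U) :
  UltraFilter F -> UltraFilter (f @ F).
Proof.
move=> UF; split=> [|G PG sG]; first exact: fmap_proper_filter.
apply/seteqP; split=> // A GA.
have [//|FnA] := in_ultra_setVsetC (f @^-1` A) UF.
have GnA : G (~` A) by apply: sG.
have := @filter_ex _ _ PG _ (filterI GA GnA).
by case=> x [].
Qed.

Lemma ultra_bounded T (F : set_system T) (f : T -> M3) : UltraFilter F ->
  (forall t i j, `|f t i j| <= 1) -> exists x : M3, f @ F --> x.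
Proof.
move=> UF f1; have := @compact_box R 0 1; rewrite compact_ultra.
move=> /(_ (f @ F) (ultra_fmap f UF)) [|x [_ fx]]; last by exists x.
apply: (@filterS _ F _ setT); last exact: filterT.
by move=> t _ i j; rewrite mxE in_itv /= -ler_distlC sub0r normrN.
Qed.

(** The data are also chosen when K is not a Cartan subgroup, so that their
    properties hold everywhere; only the last clause refers to Cartan
    subgroups. *)
Lemma cartan_data (K : closedSubgroup R) :
  exists kb : M3 * ('I_3 -> M3), let: (k, b) := kb in
    [/\ triAlg k (spanb b), k^T *m k = 1%:M, invmx k = k^T, tr_orthonormal b &
        Cartan K -> (K : set M3) = posSL k (spanb b)].
Proof.
have data u : SL3 u -> exists kb : M3 * ('I_3 -> M3), let: (k, b) := kb in
    [/\ triAlg k (spanb b), k^T *m k = 1%:M, invmx k = k^T, tr_orthonormal b &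
        conj_by u (@diag_pos R) = posSL k (spanb b)].
  move=> su; have [k [sk kk ik uk]] := triangular_frame su.
  have aC := triAlg_diag sk su uk.
  have [b ob bE] := orthonormal_basis (triAlg_dim aC).
  by exists (k, b); rewrite bE; split=> //; exact: conj_diag_pos.
have [[u su KE]|nK] := pselect (Cartan K).
  have [[k b] [? ? ? ? E]] := data u su; exists (k, b); split=> // _.
  by rewrite KE.
have [|[k b] [? ? ? ? _]] := data 1%:M; first by rewrite /SL3 /= det1.
by exists (k, b); split.
Qed.

(** Along an ultrafilter of Cartan subgroups that tends to H, the orthogonal
    frames and the orthonormal bases converge, because their entries are bounded
    by 1.  The limits still form an orthogonal frame and an orthonormal basis, so
    the limit algebra has dimension 3. *)
Lemma closure_Cartan_ex (H : closedSubgroup R) : closure (@Cartan R) H ->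
  exists g, exists2 C : {vspace M3}, triAlg g C & (H : set M3) = posSL g C.
Proof.
rewrite closureEcvg => -[G PG [GH GC]].
have [U [UU GU]] := ultraFilterLemma PG.
have UH : U --> H by move=> A /GH /GU.
have UC : U (@Cartan R) by apply: GU; exact: GC.
have /choice[kb kbP] := cartan_data.
pose k K := (kb K).1; pose b i K := (kb K).2 i.
have {}kbP K : [/\ triAlg (k K) (spanb (b ^~ K)), (k K)^T *m k K = 1%:M,
    invmx (k K) = (k K)^T, tr_orthonormal (b ^~ K) &
    Cartan K -> (K : set M3) = posSL (k K) (spanb (b ^~ K))].
  by have := kbP K; rewrite /k /b; case: (kb K) => k0 b0.
have ok K : tr_orthonormal (b ^~ K) by have [] := kbP K.
have k_bound K i j : `|k K i j| <= 1.
  have [_ kk _ _ _] := kbP K.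
  have /matrixP/(_ j j) := kk; rewrite !mxE eqxx (bigD1 i)//= mxE -expr2 => E.
  have : k K i j ^+ 2 <= 1.
    rewrite -[leRHS]E lerDl sumr_ge0// => l _.
    by rewrite [(k K)^T j l]mxE -expr2 sqr_ge0.
  by rewrite -[X in _ <= X](expr1n _ 2) -real_normK ?num_real// ler_pXn2r ?nnegrE.
have [k0 kk0] := ultra_bounded UU k_bound.
have /choice[b0 bb0] : forall i, exists x : M3, b i @ U --> x.
  by move=> i; apply: ultra_bounded => K p q; exact: (orthonormal_bound i p q (ok K)).
have kt0 : (fun K => (k K)^T) @ U --> k0^T by exact: cvg_trmx.
have ik0 : (fun K => invmx (k K)) @ U --> k0^T.
  rewrite (_ : (fun K => _) = fun K => (k K)^T)//.
  by apply/funext => K; have [] := kbP K.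
have k0k0 : k0^T *m k0 = 1%:M.
  have c1 : (fun K => (k K)^T *m k K) @ U --> k0^T *m k0 by exact: cvg_mulmx.
  apply: (cvg_unique _ c1); first exact: norm_hausdorff.
  rewrite (_ : (fun K => _) = fun=> 1%:M); first exact: cvg_cst.
  by apply/funext => K; have [] := kbP K.
have sk0 : SL3 k0.
  have c1 : (fun K => \det (k K)) @ U --> \det k0 by exact: cvg_det.
  apply: (cvg_unique _ c1); first exact: norm_hausdorff.
  rewrite (_ : (fun K => _) = fun=> 1); first exact: cvg_cst.
  by apply/funext => K; have [/triAlg_SL] := kbP K.
have iE : invmx k0 = k0^T.
  by apply: (can_inj (mulKmx (SL3_unit sk0))); rewrite mulmxV ?SL3_unit// mulmx1C.
rewrite -iE in ik0.
have ob0 : tr_orthonormal b0.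
  move=> i j.
  have c1 : (fun K => \tr (b i K *m (b j K)^T)) @ U --> \tr (b0 i *m (b0 j)^T).
    apply: cvg_big => [|l _]; first exact: add_continuous.
    by apply: cvg_coord; apply: cvg_mulmx => //; exact: cvg_trmx.
  apply: (cvg_unique _ c1); first exact: norm_hausdorff.
  rewrite (_ : (fun K => _) = fun=> (i == j)%:R); first exact: cvg_cst.
  by apply/funext => K; exact: ok.
have cvg_comb (v : closedSubgroup R -> 'rV[R]_3) v0 : v @ U --> v0 ->
    (fun K => comb (b ^~ K) (v K)) @ U --> comb b0 v0.
  move=> vv; apply: cvg_big => [|i _]; first exact: add_continuous.
  by apply: cvgZ => //; exact: cvg_coord.
have lim_span c : c \in spanb b0 ->
    exists2 f : closedSubgroup R -> M3,
      (forall K, f K \in spanb (b ^~ K)) & f @ U --> c.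
  move=> /spanbP[v ->]; exists (fun K => comb (b ^~ K) v).
    by move=> K; apply/spanbP; exists v.
  by apply: cvg_comb; exact: cvg_cst.
have aC : triAlg k0 (spanb b0).
  split=> //; last exact: dim_spanb.
  - move=> c /lim_span[f fC fc]; apply: (tri_cvg kk0 ik0 fc).
    by apply: nearW => K; have [/triAlg_tri + _ _ _ _] := kbP K; apply.
  - apply/spanbP; exists (\row_i \tr (b0 i)^T).
    have c1 : (fun K => comb (b ^~ K) (\row_i \tr (b i K)^T)) @ U -->
        comb b0 (\row_i \tr (b0 i)^T).
      apply: cvg_comb; apply: cvg_mx_coord => p q; rewrite mxE.
      under eq_cvg do rewrite mxE.
      apply: cvg_big => [|l _]; first exact: add_continuous.
      by apply: cvg_coord; exact: cvg_trmx.
    apply/esym; apply: (cvg_unique _ c1); first exact: norm_hausdorff.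
    rewrite (_ : (fun K => _) = fun=> 1%:M); first exact: cvg_cst.
    apply/funext => K; have [/triAlg_1 C1 _ _ _ _] := kbP K.
    rewrite [RHS](spanb_expand (ok K) C1); congr comb.
    by apply/rowP => i; rewrite !mxE mul1mx.
  - move=> c d /lim_span[f fC fc] /lim_span[h hC hd].
    apply: (commute_cvg fc hd); apply: nearW => K.
    by have [/triAlg_comm + _ _ _ _] := kbP K; apply.
exists k0, (spanb b0) => //.
have aCt : \forall K \near U, triAlg (k K) (spanb (b ^~ K)).
  by apply: nearW => K; have [] := kbP K.
have CtC c : c \in spanb b0 -> exists2 f : closedSubgroup R -> M3,
    (\forall K \near U, f K \in spanb (b ^~ K)) & f @ U --> c.
  by move=> /lim_span[f fC fc]; exists f => //; exact: nearW.
have KE : \forall K \near U, csub_set K = posSL (k K) (spanb (b ^~ K)).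
  by apply: filterS UC => K CK; have [_ _ _ _] := kbP K; apply.
apply/seteqP; split=> h.
  move=> /(csub_lim_in UH)[f fK fh].
  apply: (posSL_lim_out kk0 ik0 aC aCt CtC _ fh).
  by apply: filterS KE => K <-.
move=> /(posSL_lim_in kk0 ik0 aCt CtC)[f fP fh].
apply: (csub_lim_out UH _ fh).
by apply: filterS2 KE fP => K ->.
Qed.

End LimitsOfCartans.

(** * Explicit triangular matrices *)

Section Diagonalization.
Variable R : realType.
Local Notation M3 := 'M[R]_3.
Implicit Types (g k u x y z : M3) (C : {vspace M3}).

Definition o0 : 'I_3 := inord 0.
Definition o1 : 'I_3 := inord 1.
Definition o2 : 'I_3 := inord 2.

Lemma I3P (P : 'I_3 -> Prop) : P o0 -> P o1 -> P o2 -> forall i, P i.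
Proof.
move=> P0 P1 P2 [[|[|[|//]]] i3].
- by rewrite (_ : Ordinal i3 = o0)//; apply/val_inj; rewrite /= inordK.
- by rewrite (_ : Ordinal i3 = o1)//; apply/val_inj; rewrite /= inordK.
- by rewrite (_ : Ordinal i3 = o2)//; apply/val_inj; rewrite /= inordK.
Qed.

Lemma sum3 (V : nmodType) (f : 'I_3 -> V) : \sum_i f i = f o0 + f o1 + f o2.
Proof.
rewrite !big_ord_recr big_ord0 /= add0r; congr (f _ + f _ + f _);
  by apply/val_inj; rewrite /= inordK.
Qed.

Lemma o_neq : ((o0 == o1) = false) * ((o0 == o2) = false) *
  ((o1 == o0) = false) * ((o1 == o2) = false) * ((o2 == o0) = false) * ((o2 == o1) = false).
Proof. by rewrite -!val_eqE /= !inordK. Qed.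

Lemma upperE y : upper y -> (y o1 o0 = 0) * (y o2 o0 = 0) * (y o2 o1 = 0).
Proof. by move=> uy; rewrite !uy// !inordK. Qed.

(** The upper triangular matrix with diagonal a, b, c, entries p, q above the
    diagonal and r in the corner. *)
Definition upmx (a b c p q r : R) : M3 := \matrix_(i, j)
  if i == o0 then (if j == o0 then a else if j == o1 then p else r) else
  if i == o1 then (if j == o0 then 0 else if j == o1 then b else q) else
  if j == o2 then c else 0.

Lemma upmxE y : upper y ->
  y = upmx (y o0 o0) (y o1 o1) (y o2 o2) (y o0 o1) (y o1 o2) (y o0 o2).
Proof.
move=> /upperE uy; apply/matrixP; apply: I3P; apply: I3P;
  by rewrite mxE ?eqxx ?o_neq ?uy.
Qed.

Lemma upper_upmx a b c p q r : upper (upmx a b c p q r).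
Proof.
by apply: I3P; apply: I3P; rewrite !inordK// => _; rewrite mxE ?eqxx ?o_neq.
Qed.

Lemma upmxM a b c p q r a' b' c' p' q' r' :
  upmx a b c p q r *m upmx a' b' c' p' q' r' =
  upmx (a * a') (b * b') (c * c') (a * p' + p * b') (b * q' + q * c')
       (a * r' + p * q' + r * c').
Proof.
apply/matrixP; apply: I3P; apply: I3P; rewrite mxE sum3 !mxE ?eqxx ?o_neq; ring.
Qed.

Lemma upmxD a b c p q r a' b' c' p' q' r' :
  upmx a b c p q r + upmx a' b' c' p' q' r' =
  upmx (a + a') (b + b') (c + c') (p + p') (q + q') (r + r').
Proof.
by apply/matrixP; apply: I3P; apply: I3P; rewrite !mxE ?eqxx ?o_neq ?addr0.
Qed.

Lemma upmxB a b c p q r a' b' c' p' q' r' :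
  upmx a b c p q r - upmx a' b' c' p' q' r' =
  upmx (a - a') (b - b') (c - c') (p - p') (q - q') (r - r').
Proof.
by apply/matrixP; apply: I3P; apply: I3P; rewrite !mxE ?eqxx ?o_neq ?subrr.
Qed.

Lemma upmxZ s a b c p q r :
  s *: upmx a b c p q r = upmx (s * a) (s * b) (s * c) (s * p) (s * q) (s * r).
Proof.
by apply/matrixP; apply: I3P; apply: I3P; rewrite !mxE ?eqxx ?o_neq ?mulr0.
Qed.

Lemma upmx1 s : s%:M = upmx s s s 0 0 0.
Proof.
by apply/matrixP; apply: I3P; apply: I3P; rewrite !mxE ?eqxx ?o_neq.
Qed.

Lemma det_upmx a b c p q r : \det (upmx a b c p q r) = a * b * c.
Proof.
rewrite det_upper; last exact: upper_upmx.
rewrite !big_ord_recr big_ord0 /= mul1r.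
rewrite (_ : widen_ord _ (widen_ord _ _) = o0); last by apply/val_inj; rewrite /= inordK.
rewrite (_ : widen_ord _ _ = o1); last by apply/val_inj; rewrite /= inordK.
rewrite (_ : ord_max = o2); last by apply/val_inj; rewrite /= inordK.
by rewrite !mxE ?eqxx ?o_neq.
Qed.

(** The columns of u are eigenvectors normalized to have 1 on the diagonal. *)
Lemma upper_diagonalize y : upper y -> injective (fun i => y i i) ->
  exists u, [/\ SL3 u, upper u & fr u y = diag_mx (\row_i y i i)].
Proof.
move=> /upmxE yE inj; have dist i j : i != j -> y i i - y j j != 0.
  by rewrite subr_eq0; apply: contra => /eqP/inj ->.
have := dist o1 o0; have := dist o2 o1; have := dist o2 o0.
rewrite !o_neq => /(_ isT) d20 /(_ isT) d21 /(_ isT) d10.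
set a := y o0 o0 in yE d20 d10; set b := y o1 o1 in yE d21 d10.
set c := y o2 o2 in yE d20 d21.
set p := y o0 o1 in yE; set q := y o1 o2 in yE; set r := y o0 o2 in yE.
pose u01 := p / (b - a); pose u12 := q / (c - b).
pose u := upmx 1 1 1 u01 u12 ((p * u12 + r) / (c - a)).
have su : SL3 u by rewrite /SL3 /= det_upmx !mulr1.
exists u; split=> //; first exact: upper_upmx.
have uu := SL3_unit su.
have -> : diag_mx (\row_i y i i) = upmx a b c 0 0 0.
  by apply/matrixP; apply: I3P; apply: I3P; rewrite !mxE ?eqxx ?o_neq.
rewrite /fr -mulmxA (_ : y *m u = u *m upmx a b c 0 0 0); first by rewrite mulKmx.
rewrite yE /u !upmxM; congr upmx; rewrite /u01 /u12; field; rewrite ?d20 ?d21 ?d10//.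
Qed.

Lemma commute_diag (d : 'rV[R]_3) x : injective (fun i => d 0 i) ->
  x *m diag_mx d = diag_mx d *m x -> x = diag_mx (\row_i x i i).
Proof.
move=> inj /matrixP xd; apply/matrixP => i j; rewrite !mxE.
have [->|ij] := eqVneq i j; first by rewrite mulr1n.
have := xd i j; rewrite mul_mx_diag mul_diag_mx !mxE mulr0n => /eqP.
rewrite mulrC -subr_eq0 -mulrBl mulf_eq0 subr_eq0 => /orP[/eqP/inj ji|/eqP//].
by rewrite ji eqxx in ij.
Qed.

Lemma tri_id y : tri 1%:M y -> upper y.
Proof. by rewrite /tri /fr invmx1 mul1mx mulmx1. Qed.

Lemma triAlg_fr g C : triAlg g C -> triAlg 1%:M (linfun (fr g) @: C)%VS.
Proof.
move=> [sg tC C1 cC dC]; have ug := SL3_unit sg.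
split.
- by rewrite /SL3 /= det1.
- move=> _ /memv_imgP[c cC1 ->]; rewrite lfunE /= /tri /fr invmx1 mul1mx mulmx1.
  exact: tC.
- by apply/memv_imgP; exists 1%:M => //; rewrite lfunE /= fr1.
- move=> _ _ /memv_imgP[c cC1 ->] /memv_imgP[d dC1 ->].
  by rewrite !lfunE /= -!frM// (cC c d).
rewrite limg_dim_eq//; apply/eqP; rewrite -subv0; apply/subvP => y.
rewrite memv_cap memv_ker memv0 lfunE => /andP[_ /eqP fy].
by apply/eqP/(fr_inj ug); rewrite fy linear0.
Qed.

End Diagonalization.

(** * Approximation by Cartan subgroups *)

Section Approximation.
Variable R : realType.
Local Notation M3 := 'M[R]_3.
Implicit Types (g k u x y z : M3) (C : {vspace M3}).

(** C is contained in the limit of the centralizers of the matrices x n, which are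
    triangular and eventually have distinct eigenvalues. *)
Definition regular_limit C := exists x : nat -> M3,
  [/\ forall n, upper (x n),
      \forall n \near \oo, injective (fun i => x n i i) &
      forall c, c \in C -> exists2 f : nat -> M3,
        (forall n, f n *m x n = x n *m f n) & f @ \oo --> c].

Lemma upper_CH y : upper y ->
  (y - (y o0 o0)%:M) *m (y - (y o1 o1)%:M) *m (y - (y o2 o2)%:M) = 0.
Proof.
move=> /upmxE; move: (y o0 o0) (y o1 o1) (y o2 o2) => a b c ->.
rewrite !upmx1 !upmxB !upmxM [RHS](_ : 0 = upmx 0 0 0 0 0 0).
  by congr upmx; ring.
by rewrite -upmx1 raddf0.
Qed.

(** With q = (X - b)(X - c), the polynomial (q / q(l)) ^ 2 - q / q(l) is a multiple
    of (X - l) q, since q - q(l) vanishes at l. *)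
Lemma idempotent_of_root y l b c :
  horner_mx y (('X - l%:P) * ('X - b%:P) * ('X - c%:P)) = 0 ->
  l != b -> l != c ->
  let e := ((l - b) * (l - c))^-1 *: ((y - b%:M) *m (y - c%:M)) in e *m e = e.
Proof.
move=> CH lb lc e; pose k := ((l - b) * (l - c))^-1.
have kE : k%:P * ((l%:P - b%:P) * (l%:P - c%:P)) = 1.
  rewrite -!polyCB -!polyCM mulVf// mulf_neq0// subr_eq0//.
pose p := k%:P * (('X - b%:P) * ('X - c%:P)).
have eE : e = horner_mx y p.
  by rewrite /e /p !rmorphM !rmorphB /= !horner_mx_X !horner_mx_C -mul_scalar_mx.
apply/eqP; rewrite -subr_eq0; apply/eqP.
have -> : e *m e - e = horner_mx y (p * p - p) by rewrite rmorphB rmorphM /= -eE.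
have -> : p * p - p = k%:P * k%:P * ('X + l%:P - b%:P - c%:P) *
    (('X - l%:P) * ('X - b%:P) * ('X - c%:P)).
  rewrite -[X in _ - X]mul1r -{1}kE /p; ring.
by rewrite rmorphM /= CH mulr0.
Qed.

(** If the diagonal of z is not constant, one of its three entries differs from
    both others; e is the spectral projection for this eigenvalue. *)
Lemma separating_idempotent C z i j : triAlg 1%:M C -> z \in C ->
  z i i != z j j -> exists e, [/\ e \in C, e *m e = e & forall a, e != a%:M].
Proof.
move=> aC zC zij; have [_ tC C1 _ _] := aC.
have uz : upper z by exact/tri_id/tC.
have CH : horner_mx z (('X - (z o0 o0)%:P) * ('X - (z o1 o1)%:P) *
    ('X - (z o2 o2)%:P)) = 0.
  by rewrite !rmorphM !rmorphB /= !horner_mx_X !horner_mx_C; exact: upper_CH.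
suff [l [b [c [H lb lc [p [q [pl qbc]]]]]]] : exists l b c,
    [/\ horner_mx z (('X - l%:P) * ('X - b%:P) * ('X - c%:P)) = 0, l != b, l != c &
        exists p q, z p p = l /\ (z q q = b \/ z q q = c)].
  pose k := ((l - b) * (l - c))^-1.
  have k0 : k * ((l - b) * (l - c)) = 1 by rewrite mulVf// mulf_neq0// subr_eq0.
  exists (k *: ((z - b%:M) *m (z - c%:M))).
  have uB s : upper (z - s%:M).
    by move=> r s' rs; rewrite !mxE uz// -val_eqE gtn_eqF// mulr0n subr0.
  have zB s : z - s%:M \in C by rewrite memvB// -scalemx1 memvZ.
  split; first by apply/memvZ/(triAlgM aC).
    exact: idempotent_of_root.
  move=> a; apply/eqP => /matrixP ea.
  have d s : k * ((z s s - b) * (z s s - c)) = a.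
    have := ea s s; rewrite mxE upper_diagM; [|exact: uB..].
    by rewrite !mxE !eqxx !mulr1n.
  have := d p; rewrite pl k0 => a1.
  have := d q; rewrite -a1 => /eqP.
  by case: qbc => ->; rewrite subrr ?mul0r ?mulr0 eq_sym oner_eq0.
have [e01|n01] := eqVneq (z o0 o0) (z o1 o1).
  have n2 : z o2 o2 != z o0 o0.
    apply/eqP => e2; move/eqP: zij; apply.
    by move: i j; apply: I3P; apply: I3P; rewrite ?e2 -?e01.
  exists (z o2 o2), (z o0 o0), (z o1 o1); split; rewrite -?e01//.
    by rewrite -[RHS]CH -e01; congr horner_mx; ring.
  by exists o2, o0; split=> //; left.
have [e02|n02] := eqVneq (z o0 o0) (z o2 o2).
  exists (z o1 o1), (z o0 o0), (z o2 o2); split; rewrite -?e02// 1?eq_sym//.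
    by rewrite -[RHS]CH -e02; congr horner_mx; ring.
  by exists o1, o0; split=> //; left.
exists (z o0 o0), (z o1 o1), (z o2 o2); split=> //.
by exists o0, o1; split=> //; left.
Qed.

Lemma dim_addv_line C x : x \notin C -> \dim (C + <[x]>)%VS = (\dim C).+1.
Proof.
move=> xC; rewrite dimv_disjoint_sum ?dim_vline.
  by case: eqVneq xC => [->|_ _]; rewrite ?mem0v// addn1.
apply/eqP; rewrite -subv0; apply/subvP => y; rewrite memv_cap memv0.
move=> /andP[yC /vlineP[a yE]]; rewrite yE in yC *.
have [->|a0] := eqVneq a 0; first by rewrite scale0r.
by rewrite -[x](scalerK a0) memvZ in xC.
Qed.

Lemma cvg_harmonic_scale (x : M3) : (fun n => n.+1%:R^-1 *: x) @ \oo --> (0 : M3).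
Proof.
rewrite -[X in _ --> X](scale0r x); apply: cvgZ; last exact: cvg_cst.
exact: cvg_harmonic.
Qed.

(** C is spanned by 1, e and some x.  For t diagonal with distinct entries, the
    matrix r = e t e + (1 - e) t (1 - e) commutes with e and has the diagonal of
    t.  Hence x + r / (n + 1) commutes with e and has distinct eigenvalues for n
    large. *)
Lemma regular_limit_idempotent C e : triAlg 1%:M C -> e \in C -> e *m e = e ->
  (forall a, e != a%:M) -> regular_limit C.
Proof.
move=> aC eC ee ne; have [_ tC C1 cC dC] := aC.
have e1 : e \notin <[1%:M]>%VS.
  by apply/negP => /vlineP[a eE]; have := ne a; rewrite eE scalemx1 eqxx.
pose D := (<[1%:M]> + <[e]>)%VS.
have dD : \dim D = 2%N by rewrite dim_addv_line// dim_vline oner_eq0.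
have /subvPn[x xC xD] : ~~ (C <= D)%VS by apply/negP => /dimvS; rewrite dC dD.
have CE : (D + <[x]>)%VS = C.
  apply/eqP; rewrite eqEdim (dim_addv_line xD) dC dD leqnn andbT.
  by rewrite subv_add -memvE xC andbT subv_add -!memvE C1.
have ue : upper e by exact/tri_id/tC.
pose t : M3 := upmx 0 1 2 0 0 0.
have ut : upper t by exact: upper_upmx.
pose e' : M3 := 1%:M - e.
have ue' : upper e' by move=> i j ij; rewrite !mxE ue// -val_eqE gtn_eqF// subr0.
pose r := e *m t *m e + e' *m t *m e'.
have ur : upper r.
  have uete := upperM (upperM ue ut) ue; have uf := upperM (upperM ue' ut) ue'.
  by move=> i j ij; rewrite mxE uete ?uf ?addr0.
have ee' : e *m e' = 0 by rewrite mulmxBr mulmx1 ee subrr.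
have e'e : e' *m e = 0 by rewrite mulmxBl mul1mx ee subrr.
have er : e *m r = r *m e.
  rewrite mulmxDl mulmxDr !mulmxA ee ee' !mul0mx addr0.
  by rewrite -[_ *m e *m e]mulmxA ee -[_ *m e' *m e]mulmxA e'e mulmx0 addr0.
have rii i : r i i = t i i.
  rewrite mxE !upper_diagM//; try exact: upperM.
  have : e i i * e i i = e i i by rewrite -upper_diagM// ee.
  rewrite [e' i i]mxE [(- e) i i]mxE [1%:M i i]mxE eqxx.
  move: (e i i) (t i i) => a s aa.
  have -> : a * s * a + (1 - a) * s * (1 - a) = s * (1 + (a * a - a) * 2) by ring.
  by rewrite aa subrr mul0r addr0 mulr1.
have t_inj i j : i != j -> t i i != t j j.
  move: i j; apply: I3P; apply: I3P; rewrite ?eqxx// !mxE ?eqxx ?o_neq => _ //;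
    by rewrite ?(eq_sym 1) ?(eq_sym 0) ?oner_eq0 ?pnatr_eq0 ?(eqr_nat R 2 1)
       ?(eqr_nat R 1 2).
pose xn n := x + n.+1%:R^-1 *: r.
have xnx : xn @ \oo --> x.
  rewrite -[X in _ --> X]addr0; apply: cvgD; [exact: cvg_cst|exact: cvg_harmonic_scale].
have xnE n i j : xn n i j = x i j + n.+1%:R^-1 * r i j.
  by rewrite mxE [X in _ + X]mxE.
exists xn; split.
- by move=> n i j ij; rewrite xnE ur// (tri_id (tC _ xC))// mulr0 addr0.
- have dist i j : \forall n \near \oo, i != j -> xn n i i != xn n j j.
    have [eqx|nx] := eqVneq (x i i) (x j j).
      apply: nearW => n ij; rewrite !xnE eqx !rii (inj_eq (addrI _)).
      by rewrite (inj_eq (mulfI _)) ?invr_eq0 ?pnatr_eq0// t_inj.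
    have : (fun n => xn n i i - xn n j j) @ \oo --> x i i - x j j.
      by apply: cvgB; exact: cvg_coord.
    move=> /cvgr_neq0; rewrite subr_eq0 => /(_ nx); apply: filterS => n.
    by rewrite subr_eq0.
  have dist1 i : \forall n \near \oo, forall j, i != j -> xn n i i != xn n j j.
    exact: filter_forall (dist i).
  have : \forall n \near \oo, forall i j, i != j -> xn n i i != xn n j j.
    exact: filter_forall dist1.
  apply: filterS => n inj i j.
  by move=> /eqP xij; apply/eqP; apply: contraTT xij; exact: inj.
move=> c; rewrite -CE => /memv_addP[d + [_ /vlineP[s ->] ->]].
move=> /memv_addP[_ /vlineP[a ->] [_ /vlineP[b ->] ->]].
exists (fun n => a *: 1%:M + b *: e + s *: xn n).
  move=> n; have exn : e *m xn n = xn n *m e.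
    by rewrite mulmxDr mulmxDl -scalemxAl -scalemxAr (cC e x)// er.
  move: (xn n) exn => w ew.
  by rewrite !mulmxDl !mulmxDr -!scalemxAl -!scalemxAr mul1mx mulmx1 ew.
by apply: cvgD; [exact: cvg_cst | apply: cvgZ => //; exact: cvg_cst].
Qed.

Lemma cvg_neq0_approx (p : R) :
  exists2 f : nat -> R, (forall n, f n != 0) & f @ \oo --> p.
Proof.
have [->|p0] := eqVneq p 0; last by exists (fun=> p) => //; exact: cvg_cst.
exists (fun n => n.+1%:R^-1); last exact: cvg_harmonic.
by move=> n; rewrite invr_eq0 pnatr_eq0.
Qed.

(** Modulo scalars, C consists of the matrices s w + r E with w = p E01 + q E12 and
    E = E02, for fixed p and q, because the commutator of two strictly upper
    triangular matrices is the determinant of their first superdiagonals.  With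
    w_n = p_n E01 + q_n E12, where p_n and q_n are nonzero and tend to p and q,
    and x_n = w_n + d_n diag (0, 1, 2), the commuting matrices x_n and
    x_n ^ 2 / (p_n q_n) tend to w and E, provided that d_n is small compared with
    p_n q_n. *)
Lemma regular_limit_unipotent C : triAlg 1%:M C ->
  (forall z i j, z \in C -> z i i = z j j) -> regular_limit C.
Proof.
move=> aC diag; have [_ tC C1 cC dC] := aC.
have CE z : z \in C ->
    z = upmx (z o0 o0) (z o0 o0) (z o0 o0) (z o0 o1) (z o1 o2) (z o0 o2).
  move=> zC; rewrite {1}(upmxE (tri_id (tC _ zC))).
  by rewrite (diag z o1 o0 zC) (diag z o2 o0 zC).
have cross y z : y \in C -> z \in C -> y o0 o1 * z o1 o2 = z o0 o1 * y o1 o2.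
  move=> yC zC; have /matrixP/(_ o0 o2) := cC y z yC zC.
  rewrite (congr2 mulmx (CE y yC) (CE z zC)) (congr2 mulmx (CE z zC) (CE y yC)).
  rewrite !upmxM.
  by rewrite !mxE ?eqxx ?o_neq => h; lra.
have [p [q pq]] : exists p q, forall c, c \in C ->
    exists s, c o0 o1 = s * p /\ c o1 o2 = s * q.
  have [[y yC ny]|ny] := pselect (exists2 y, y \in C &
      (y o0 o1 != 0) || (y o1 o2 != 0)).
    exists (y o0 o1), (y o1 o2) => c cC1; have := cross y c yC cC1.
    case/orP: ny => n0 E.
      exists (c o0 o1 / y o0 o1); split; first by rewrite divfK.
      by rewrite mulrAC -E mulrAC mulfV// mul1r.
    exists (c o1 o2 / y o1 o2); split; last by rewrite divfK.
    by rewrite mulrAC [_ * y o0 o1]mulrC E mulfK.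
  exists 0, 0 => c cC1; exists 0; rewrite mulr0.
  split; apply/eqP; apply: contrapT => /negP n0; apply: ny; exists c => //.
    by rewrite n0.
  by rewrite n0 orbT.
have [pn pn0 pnp] := cvg_neq0_approx p.
have [qn qn0 qnq] := cvg_neq0_approx q.
pose ep n : R := n.+1%:R^-1.
have ep0 : ep @ \oo --> (0 : R) by exact: cvg_harmonic.
(* The factor p_n q_n makes dl n negligible after division by p_n q_n. *)
pose dl n := ep n * (pn n * qn n).
have dl0 : dl @ \oo --> (0 : R).
  by rewrite -(mul0r (p * q)); apply: cvgM => //; exact: cvgM.
pose xn n : M3 := upmx 0 (dl n) (2 * dl n) (pn n) (qn n) 0.
have cvg_upmx (a b c p' q' r : nat -> R) a0 b0 c0 p0 q0 r0 :
    a @ \oo --> a0 -> b @ \oo --> b0 -> c @ \oo --> c0 -> p' @ \oo --> p0 ->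
    q' @ \oo --> q0 -> r @ \oo --> r0 ->
    (fun n => upmx (a n) (b n) (c n) (p' n) (q' n) (r n)) @ \oo -->
      upmx a0 b0 c0 p0 q0 r0.
  move=> *; apply: cvg_mx_coord; apply: I3P; apply: I3P; rewrite mxE ?eqxx ?o_neq;
    (under eq_cvg do rewrite mxE ?eqxx ?o_neq) => //; exact: cvg_cst.
have xw : xn @ \oo --> (upmx 0 0 0 p q 0 : M3).
  apply: cvg_upmx => //; try exact: cvg_cst.
  by rewrite -[X in _ --> X](mulr0 2); apply: cvgM => //; exact: cvg_cst.
pose x2 n := (pn n * qn n)^-1 *: (xn n *m xn n).
have x2E : x2 @ \oo --> (upmx 0 0 0 0 0 1 : M3).
  have -> : x2 = fun n => upmx 0 (ep n * dl n) (4 * (ep n * dl n)) (ep n * pn n)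
      (3 * (ep n * qn n)) 1.
    apply/funext => n; rewrite /x2 /xn upmxM upmxZ /dl.
    by congr upmx; field; rewrite ?pn0 ?qn0 ?pnatr_eq0.
  have e0 (f : nat -> R) (l : R) : f @ \oo --> l -> (fun n => ep n * f n) @ \oo --> (0 : R).
    by move=> fl; rewrite -(mul0r l); exact: cvgM.
  have s0 (s : R) (f : nat -> R) : f @ \oo --> (0 : R) -> (fun n => s * f n) @ \oo --> (0 : R).
    by move=> fl; rewrite -(mulr0 s); apply: cvgM => //; exact: cvg_cst.
  apply: cvg_upmx; [exact: cvg_cst | exact: e0 dl0 | | exact: e0 pnp | |
    exact: cvg_cst]; apply: s0; [exact: e0 dl0 | exact: e0 qnq].
exists xn; split.
- by move=> n; exact: upper_upmx.
- apply: nearW => n; have d0 : dl n != 0.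
    by rewrite !mulf_neq0// invr_eq0 pnatr_eq0.
  have d2 : 2 * dl n != 0 by rewrite mulf_neq0// pnatr_eq0.
  have d12 : dl n != 2 * dl n.
    by apply/eqP => h; move/eqP: d0; apply; lra.
  apply: I3P; apply: I3P; rewrite // !mxE ?eqxx ?o_neq => /eqP //;
    by rewrite ?(negbTE d0) ?(negbTE d2) ?(negbTE d12) // eq_sym ?(negbTE d0)
       ?(negbTE d2) ?(negbTE d12).
move=> c cC1; have [s [c01 c12]] := pq c cC1.
exists (fun n => (c o0 o0)%:M + s *: xn n + c o0 o2 *: x2 n).
  move=> n; rewrite /x2 !mulmxDl !mulmxDr -!scalemxAl -!scalemxAr.
  by rewrite scalar_mxC mulmxA.
rewrite [X in _ --> X](_ : c = (c o0 o0)%:M + s *: upmx 0 0 0 p q 0 +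
    c o0 o2 *: upmx 0 0 0 0 0 1).
  apply: cvgD; last by apply: cvgZ => //; exact: cvg_cst.
  by apply: cvgD; [exact: cvg_cst | apply: cvgZ => //; exact: cvg_cst].
rewrite {1}(CE c cC1) c01 c12 upmx1 !upmxZ !upmxD; congr upmx; ring.
Qed.

Lemma triAlg_regular_limit C : triAlg 1%:M C -> regular_limit C.
Proof.
move=> aC.
have [diag|ndiag] := pselect (forall z i j, z \in C -> z i i = z j j).
  exact: regular_limit_unipotent.
have [z [i [j [zC zij]]]] : exists z i j, z \in C /\ z i i != z j j.
  apply: contrapT => H; apply: ndiag => z i j zC; apply/eqP.
  by apply: contrapT => /negP zij; apply: H; exists z, i, j.
have [e [eC ee ne]] := separating_idempotent aC zC zij.
exact: regular_limit_idempotent eC ee ne.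
Qed.

(** The centralizer of a triangular matrix with distinct eigenvalues is a
    conjugate of the diagonal algebra, whose positive unimodular elements form a
    Cartan subgroup. *)
Lemma closure_Cartan_posSL g C (H : closedSubgroup R) : triAlg g C ->
  (H : set M3) = posSL g C -> closure (@Cartan R) H.
Proof.
move=> aC HE; have [sg tC C1 cC dC] := aC; have ug := SL3_unit sg.
have [x [ux [N _ injx] xC]] := triAlg_regular_limit (triAlg_fr aC).
(* The eigenvalues of x n are distinct from the rank N on, hence the shift. *)
have /choice[u uP] : forall n, exists u,
    [/\ SL3 u, upper u & fr u (x (n + N)%N) = diag_mx (\row_i x (n + N)%N i i)].
  move=> n; apply: upper_diagonalize; first exact: ux.
  by apply: injx; rewrite /= leq_addl.
pose v n := g *m u n.
have sv n : SL3 (v n).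
  by have [su _ _] := uP n; rewrite /SL3 /= det_mulmx sg su mulr1.
have uv n : upper (invmx g *m v n) by have [_ + _] := uP n; rewrite /v mulKmx.
have aV n : triAlg g (diagAlg (v n)) := triAlg_diag sg (sv n) (uv n).
have CtC c : c \in C -> exists2 f : nat -> M3,
    (\forall n \near \oo, f n \in diagAlg (v n)) & f @ \oo --> c.
  move=> cC1; have [|f fx fc] := xC (fr g c).
    by apply/memv_imgP; exists c; rewrite ?lfunE.
  exists (fun n => g *m f (n + N)%N *m invmx g); last first.
    rewrite -[X in _ --> X](frK c ug); apply: cvg_mulmx; last exact: cvg_cst.
    by apply: cvg_mulmx; [exact: cvg_cst | rewrite (cvg_shiftn N f)].
  apply: nearW => n; have [su _ xE] := uP n; have uu := SL3_unit su.
  apply/diagAlgP; exists (\row_i fr (u n) (f (n + N)%N) i i).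
  have fE : fr (u n) (f (n + N)%N) = diag_mx (\row_i fr (u n) (f (n + N)%N) i i).
    apply: (@commute_diag _ (\row_i x (n + N)%N i i)).
      have ix : injective (fun i => x (n + N)%N i i).
        by apply: injx; rewrite /= leq_addl.
      by move=> i j; rewrite !mxE; exact: ix.
    by rewrite -xE -!frM// fx.
  rewrite /conj_diag -fE /v.
  have -> : invmx (g *m u n) = invmx (u n) *m invmx g.
    apply: (can_inj (mulKmx (SL3_unit (sv n)))).
    by rewrite mulmxV ?(SL3_unit (sv n))// /v -mulmxA mulKVmx// mulmxV.
  by rewrite -{1}(frK (f (n + N)%N) uu) !mulmxA.
pose Hn n : closedSubgroup R := ClosedSubgroup (posSL_subgroup (aV n)).
have HnC n : Cartan (Hn n).
  by exists (v n) => //; rewrite (conj_diag_pos sg (sv n) (uv n)).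
have cst (a : M3) (F : set_system nat) : Filter F -> (fun=> a) @ F --> a.
  by move=> FF; exact: cvg_cst.
suff HnH : Hn @ \oo --> H.
  move=> B /HnH[M _ BM]; exists (Hn M); split; first exact: HnC.
  by apply: BM => /=.
apply/csub_cvgP; split=> [h|phi f h phi_homo fH fh]; rewrite HE.
  move=> Ph; have aVn : \forall n \near \oo, triAlg g (diagAlg (v n)) by exact: nearW.
  have [f fP fh] := posSL_lim_in (cst _ _ _) (cst _ _ _) aVn CtC Ph.
  (* f n lies in the group only eventually; the identity replaces it before. *)
  pose f' n := if `[< posSL g (diagAlg (v n)) (f n) >] then f n else 1%:M.
  exists f'.
    move=> n; rewrite /f'; case: asboolP => // _; exact: posSL1.
  apply: cvg_trans fh; apply: near_eq_cvg; apply: filterS fP => n Pn.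
  by rewrite /f'; case: asboolP.
have phi_oo : phi @ \oo --> \oo.
  have le_phi (k : nat) : (k <= phi k)%N.
    by elim: k => // k IH; exact: leq_ltn_trans IH (phi_homo _ _ (ltnSn k)).
  by move=> A [M _ MA]; exists M => // k Mk; apply: MA; exact: leq_trans (le_phi k).
apply: (@posSL_lim_out _ _ \oo _ (fun=> g) (fun n => diagAlg (v (phi n))) g C
  (cst _ _ _) (cst _ _ _) aC _ _ f) => //.
- exact: nearW.
- move=> c /CtC[k kP kc]; exists (k \o phi); first exact: phi_oo kP.
  exact: cvg_comp phi_oo kc.
- exact: nearW.
Qed.

End Approximation.

(** * The Chabauty compactification *)

Theorem mainTheorem4 (R : realType) : closure (@Cartan R) = @calA R.
Proof.
apply/seteqP; split=> H.
  by move=> /closure_Cartan_ex[g [C aC]]; exact: calA_posSL.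
by move=> /calA_ex[g [C aC]]; exact: closure_Cartan_posSL.
Qed.
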